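(* Let $h(r)=\frac{1}{1-r}$ for $r\in(0,1)$. Let $\delta\ge0$ and let $(\theta_n)_{n\ge0}$ be a sequence of positive integers such that, for some $\varphi\in\mathcal{L}$ with $\gamma(\varphi)\le\delta$, $$\frac{\theta_{n+1}}{\theta_n}\ge1+\frac1{\varphi(n)}\qquad(n\ge0).$$ Then for every function $f(z)=\sum_{n=0}^{+\infty}a_nz^n$ analytic in the unit disc $\mathbb{D}$ and not identically zero, the set $$F_{3h}(f,\theta)=\left\{t\in\mathbb{R}:\ \varliminf_{r\to1-0}\Delta_h(r,f_t)\le\frac{1+3\delta}{4+2\delta}\right\}$$ is residual in $\mathbb{R}$, where $f_t(z)=\sum_{n=0}^{+\infty}a_ne^{i\theta_nt}z^n$.
   Context: $\mathcal{L}$ is the class of (nonnegative) functions $l$ on $[0,+\infty)$ increasing to $+\infty$; for $l\in\mathcal{L}$, $\gamma(l)=\varlimsup_{x\to+\infty}\frac{\ln l(x)}{\ln x}$. The condition involving $1/\varphi(n)$ presupposes $\varphi(n)>0$ for all integers $n\ge0$. For a power series $g(z)=\sum_{n\ge0} b_nz^n$ analytic in $\mathbb{D}$ and $r\in(0,1)$: $M_g(r)=\max\{|g(z)|:|z|=r\}$, $\mu_g(r)=\max\{|b_n|r^n:n\ge0\}$, and $$\Delta_h(r,g)=\frac{\ln M_g(r)-\ln\mu_g(r)}{2\ln h(r)+\ln\ln\{h(r)\mu_g(r)\}}$$ (defined for $r$ close to $1$). A set $B\subset\mathbb{R}$ is residual in $\mathbb{R}$ if $\mathbb{R}\setminus B$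 is of the first Baire category in $\mathbb{R}$. *)

(* Defs.v *)
From HB Require Import structures.
From mathcomp Require Import all_boot all_order all_algebra.
From mathcomp Require Import complex.
From mathcomp Require Import all_classical all_reals all_analysis.

Set Implicit Arguments.
Unset Strict Implicit.
Unset Printing Implicit Defensive.

Import Order.TTheory GRing.Theory Num.Theory.
Import numFieldNormedType.Exports.

Local Open Scope classical_set_scope.
Local Open Scope ring_scope.
Local Open Scope complex_scope.

Section BaireCategory.
Context {T : topologicalType}.
Implicit Types A : set T.

Definition nowhere_dense A := interior (closure A) = set0.

Definition first_category A :=
  exists F : nat -> set T,
    (forall n, nowhere_dense (F n)) /\ A = \bigcup_n F n.

Definition residual A := first_category (~` A).

End BaireCategory.

Section Growth.
Context {R : realType}.
Implicit Types l : R -> R.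

(* Only the values on [0, +oo) matter. Monotonicity is in the weak sense, so
   that strictly increasing functions are included. *)
Definition class_L l :=
  [/\ forall x, 0 <= x -> 0 <= l x,
      forall x y, 0 <= x -> x <= y -> l x <= l y
    & l x @[x --> +oo] --> +oo].

Definition gamma l : \bar R :=
  limf_esup (fun x : R => (ln (l x) / ln x)%:E) +oo.

End Growth.

Section PowerSeries.
Context {R : realType}.
Implicit Types (b : nat -> R[i]) (z : R[i]) (r : R).

(* The modulus as an element of R (the library's `|z| lies in R[i]). *)
Definition cmod z : R := ComplexField.Normc.normc z.

Definition cis (x : R) : R[i] := cos x +i* sin x.

(* R[i]^o is R[i] with the topology of its norm. *)
Definition partial_sums b z : nat -> R[i]^o :=
  series (fun n => b n * z ^+ n).

(* The power series with coefficients b represents an analytic function in the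
   unit disc, i.e. it converges at every point of the disc. *)
Definition analytic_in_disc b :=
  forall z, cmod z < 1 -> cvgn (partial_sums b z).

Definition power_sum b z : R[i] := limn (partial_sums b z).

(* For b analytic in the disc and 0 < r < 1 the two suprema are attained. *)
Definition max_modulus b r : R :=
  sup [set cmod (power_sum b z) | z in [set z | cmod z = r]].

Definition max_term b r : R :=
  sup [set cmod (b n) * r ^+ n | n in [set: nat]].

Definition Delta (h : R -> R) b r : R :=
  (ln (max_modulus b r) - ln (max_term b r)) /
  (2 * ln (h r) + ln (ln (h r * max_term b r))).

(* The coefficients of f_t(z) = \sum_n a_n e^(i theta_n t) z^n. *)
Definition rotate (theta : nat -> nat) (t : R) b : nat -> R[i] :=
  fun n => b n * cis ((theta n)%:R * t).

Definition h_disc r : R := (1 - r)^-1.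

Definition F3h (delta : R) (theta : nat -> nat) b : set R :=
  [set t | (limf_einf (fun r : R => (Delta h_disc (rotate theta t b) r)%:E) 1^'-
            <= ((1 + 3 * delta) / (4 + 2 * delta))%:E)%E].

End PowerSeries.

(* Main.v *)
(* Write h = 1/(1-r), L = ln(h mu(r)), B = h^2 L, so that ln B is the denominator
   of Delta. Residuality follows once, for every t*, some r near 1 and some t1 near
   t* satisfy M(r, f_t) <= mu(r) B^(C + e) for all t close to t1, where
   C = (1 + 3 delta) / (4 + 2 delta).

   Radius. Let g(x) = ln sum_n (|a_n| + 1) e^(n x), x < 0. As g is finite, a
   Borel-type argument gives x near 0 with g(x (1 - g(x)^-eps)) <= 2 g(x); since g is
   increasing, some y in that interval has second difference at most 1 for a
   step d of order |x| g^(-1/2 - eps). By Chebyshev-type concentration on an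
   interval of length O(1/d), sum_n |a_n| r^n <= c mu B^(1/2 + eps) with r = e^y, and
   the terms with n >= N, for some N <= B^(1 + 2 eps), contribute at most 1. If
   delta >= 1/2 this suffices, because then C >= 1/2.

   Rotations. If delta < 1/2, split n < N by n mod q, with q of order
   N^(delta + eps) >= phi(N), and by theta_n mod m, with m fixed and large. In each class
   the frequencies at least double, so exponential moments behave as for
   independent terms, and a union bound over classes and a grid of arguments
   yields t1 with M <= c mu + c ln N sqrt(q m sum_n |a_n|^2 r^(2 n)). As
   sum_n |a_n|^2 r^(2 n) <= c mu^2 B^(1/2 + eps), the exponent of B is at most
   1/4 + delta/2 + O(eps), and 1/4 + delta/2 <= C for delta <= 1/2. *)

Require Import Defs.
From mathcomp Require Import all_boot all_order all_algebra.
From mathcomp Require Import complex ring lra zify.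
From mathcomp Require Import all_classical all_reals all_analysis.
Import Order.TTheory GRing.Theory Num.Theory.
Import numFieldNormedType.Exports.
Local Open Scope classical_set_scope.
Local Open Scope ring_scope.

(** * Trigonometric sums with superincreasing frequencies *)

Section RandomPhases.
Context {R : realType}.

(** Squaring [1 - x / 2 <= expR (- (x / 2))] reduces this to 1 <= (1 + x + 2 x^2)(1 - x/2)^2, where
    the two sides differ by x^2 (1 - x)(5 - 2 x) / 4. *)
Lemma expR_le1DxDsqr (x : R) : `|x| <= 1 -> expR x <= 1 + x + 2 * x ^+ 2.
Proof.
rewrite ler_norml => /andP[xge xle].
have h1 : 1 - x / 2 <= expR (- (x / 2)) by have := expR_ge1Dx (- (x / 2)); lra.
have h2 : 0 < 1 - x / 2 by lra.
have -> : expR x = (expR (- (x / 2))) ^- 2.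
  by rewrite -exprVn -expRN opprK -expRM_natl; congr expR; field.
have h3 : (1 - x / 2) ^+ 2 <= expR (- (x / 2)) ^+ 2.
  by rewrite ler_pXn2r // ?nnegrE ?expR_ge0 ?ltW.
rewrite -[leLHS]mul1r ler_pdivrMr ?exprn_gt0 ?expR_gt0 //.
have h4 : 0 <= 1 + x + 2 * x ^+ 2 by nra.
apply: le_trans (ler_wpM2l h4 h3).
rewrite -subr_ge0 (_ : _ - _ = x ^+ 2 * ((1 - x) * (5 - 2 * x)) / 4); last by field.
by rewrite divr_ge0 // mulr_ge0 ?sqr_ge0 // mulr_ge0; lra.
Qed.

(** Multiplied by sin (m pi / Q), which is nonzero as 0 < m < Q, the sum telescopes, and its end
    points differ by m full periods. *)
Lemma sum_cos_roots (Q m : nat) (b : R) : (0 < m < Q)%N ->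
  \sum_(k < Q) cos (k%:R * m%:R * (2 * pi / Q%:R) + b) = 0.
Proof.
move=> /andP[m0 mQ].
have Q0 : (0 : R) < Q%:R by rewrite ltr0n; lia.
pose a : R := m%:R * (pi / Q%:R).
have sa : sin a != 0.
  have : 0 < sin a; last by move/gt_eqF => ->.
  apply: sin_gt0_pi; rewrite /a mulrA mulr_gt0 ?mulr_gt0 ?ltr0n ?invr_gt0 ?pi_gt0 //=.
  rewrite ltr_pdivrMr // mulrC ltr_pM2l ?pi_gt0 // ltr_nat //.
apply: (mulfI sa); rewrite mulr0 mulr_sumr.
pose F (k : nat) := sin (2 * k%:R * a + b - a) / 2.
have -> : \sum_(k < Q) sin a * cos (k%:R * m%:R * (2 * pi / Q%:R) + b) =
          \sum_(0 <= k < Q) (F k.+1 - F k).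
  rewrite big_mkord; apply: eq_bigr => k _; rewrite /F.
  have -> : k%:R * m%:R * (2 * pi / Q%:R) + b = 2 * k%:R * a + b by rewrite /a; ring.
  have -> : 2 * k.+1%:R * a + b - a = (2 * k%:R * a + b) + a by rewrite -natr1; ring.
  by rewrite sinD sinB; lra.
rewrite telescope_sumr // /F.
have -> : 2 * Q%:R * a + b - a = (b - a) + (pi *+ 2) *+ m.
  by rewrite /a -mulr_natr -(mulr_natr pi); field; rewrite gt_eqF.
rewrite (periodicn (@sinD2pi R)) mulr0 mul0r add0r; lra.
Qed.

(** Induction on the factors: the last one splits the outer cosine into the frequencies m,
    [m + kap p] and [m - kap p], and the two hypotheses keep all of them strictly between 0 and
    Q. *)
Lemma sum_prod_cos_eq0 (A B al : nat -> R) (kap : nat -> nat) (P : pred nat)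
    (Q p m : nat) (b : R) :
  (\sum_(i < p | P i) kap i < m)%N -> (m + \sum_(i < p | P i) kap i < Q)%N ->
  \sum_(k < Q) (\prod_(i < p | P i)
      (A i + B i * cos (k%:R * (kap i)%:R * (2 * pi / Q%:R) + al i)))
    * cos (k%:R * m%:R * (2 * pi / Q%:R) + b) = 0.
Proof.
elim: p m b => [|p IH] m b.
  rewrite big_ord0 addn0 => m0 mQ.
  under eq_bigr do rewrite big_ord0 mul1r.
  by apply: sum_cos_roots; rewrite m0.
rewrite big_mkcond big_ord_recr -big_mkcond /= => lt_m lt_Q.
under eq_bigr do rewrite big_mkcond big_ord_recr -big_mkcond /=.
case: ifP lt_m lt_Q => Pp lt_m lt_Q; last first.
  rewrite addn0 in lt_m lt_Q.
  by under eq_bigr do rewrite mulr1; apply: IH.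
have {IH} := IH; move: lt_m lt_Q; move: (\sum_(i < p | P i) kap i)%N => s lt_m lt_Q IH.
set w : R := 2 * pi / Q%:R.
pose pr (k : 'I_Q) := \prod_(i < p | P i)
  (A i + B i * cos (k%:R * (kap i)%:R * w + al i)).
have H1 : \sum_(k < Q) pr k * cos (k%:R * m%:R * w + b) = 0 by apply: IH; lia.
have H2 : \sum_(k < Q) pr k * cos (k%:R * (m + kap p)%:R * w + (b + al p)) = 0.
  by apply: IH; lia.
have H3 : \sum_(k < Q) pr k * cos (k%:R * (m - kap p)%:R * w + (b - al p)) = 0.
  by apply: IH; lia.
transitivity (A p * (\sum_(k < Q) pr k * cos (k%:R * m%:R * w + b)) +
  B p / 2 * (\sum_(k < Q) pr k * cos (k%:R * (m + kap p)%:R * w + (b + al p))) +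
  B p / 2 * (\sum_(k < Q) pr k * cos (k%:R * (m - kap p)%:R * w + (b - al p))));
  last by rewrite H1 H2 H3; ring.
rewrite !mulr_sumr -!big_split /=; apply: eq_bigr => k _; rewrite -/w -/(pr k).

have -> : k%:R * (m + kap p)%:R * w + (b + al p) =
  (k%:R * m%:R * w + b) + (k%:R * (kap p)%:R * w + al p).
  by rewrite natrD; ring.
have -> : k%:R * (m - kap p)%:R * w + (b - al p) =
  (k%:R * m%:R * w + b) - (k%:R * (kap p)%:R * w + al p).
  by rewrite natrB; [ring|lia].
by rewrite (cosD (_ + b)) cosB; field.
Qed.

(* Since kap is superincreasing, no nontrivial signed sum of its values
   vanishes modulo Q: only the constant term of the expanded product survives. *)
Lemma sum_prod_cos (A B al : nat -> R) (kap : nat -> nat) (P : pred nat) (Q p : nat) :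
  (forall j, (j < p)%N -> P j -> (\sum_(i < j | P i) kap i < kap j)%N) ->
  (forall j, (j < p)%N -> P j -> ((kap j).*2 <= Q)%N) ->
  \sum_(k < Q) (\prod_(i < p | P i)
      (A i + B i * cos (k%:R * (kap i)%:R * (2 * pi / Q%:R) + al i)))
    = Q%:R * \prod_(i < p | P i) A i.
Proof.
elim: p => [|p IH] Hs HQ.
  under eq_bigr do rewrite big_ord0.
  by rewrite big_ord0 sumr_const card_ord mulr1.
under eq_bigr do rewrite big_mkcond big_ord_recr -big_mkcond /=.
rewrite [in RHS]big_mkcond big_ord_recr -big_mkcond /=.
have IH' := IH (fun j jp => Hs j (ltnW jp)) (fun j jp => HQ j (ltnW jp)).
case: ifP => Pp; last by under eq_bigr do rewrite mulr1; rewrite mulr1.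
under eq_bigr do rewrite mulrDr mulrCA.
rewrite big_split /= -mulr_sumr -mulr_suml IH'.
have h1 := Hs p (ltnSn _) Pp; have h2 := HQ p (ltnSn _) Pp.
by rewrite sum_prod_cos_eq0 //; [ring|lia].
Qed.

(** By [expR_le1DxDsqr] each factor e^(c X) is at most (1 + 2 c^2) + c X; the product of these
    averages exactly to the product of the 1 + 2 c^2, which is at most e^2. *)
Lemma sum_expR_cos_le (c al : nat -> R) (kap : nat -> nat) (P : pred nat) (Q p : nat) :
  (forall j, (j < p)%N -> P j -> (\sum_(i < j | P i) kap i < kap j)%N) ->
  (forall j, (j < p)%N -> P j -> ((kap j).*2 <= Q)%N) ->
  \sum_(i < p | P i) c i ^+ 2 <= 1 ->
  \sum_(k < Q) expR (\sum_(i < p | P i)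
      c i * cos (k%:R * (kap i)%:R * (2 * pi / Q%:R) + al i))
    <= Q%:R * expR 2.
Proof.
move=> Hs HQ Hc.
apply: (@le_trans _ _ (\sum_(k < Q) (\prod_(i < p | P i)
      ((1 + 2 * c i ^+ 2) + c i * cos (k%:R * (kap i)%:R * (2 * pi / Q%:R) + al i))))).
  apply: ler_sum => k _; rewrite expR_sum; apply: ler_prod => i Pi.
  rewrite expR_ge0 /=; set C := cos _.
  have ci1 : `|c i| <= 1.
    rewrite -(@expr_le1 _ 2) // real_normK ?num_real //.
    apply: le_trans Hc; rewrite (bigD1 i) //= lerDl.
    by apply: sumr_ge0 => *; exact: sqr_ge0.
  have C1 : `|C| <= 1 := cos_max _.
  have CC : C ^+ 2 <= 1 by rewrite -real_normK ?num_real // expr_le1.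
  have /expR_le1DxDsqr/le_trans : `|c i * C| <= 1 by rewrite normrM mulr_ile1.
  apply.
  have : c i ^+ 2 * C ^+ 2 <= c i ^+ 2 by rewrite ler_piMr ?sqr_ge0.
  by rewrite exprMn; lra.
rewrite (sum_prod_cos (fun i => 1 + 2 * c i ^+ 2)) // ler_wpM2l //.
apply: (@le_trans _ _ (\prod_(i < p | P i) expR (2 * c i ^+ 2))).
  apply: ler_prod => i _; rewrite expR_ge1Dx andbT.
  by have := sqr_ge0 (c i); lra.
by rewrite -expR_sum -mulr_sumr ler_expR; lra.
Qed.

(** Union bound with exponential moments: if every k had a bad w, then [\sum_w expR (X w k)] would
    exceed [expR 2 * #|T|] for every k, against the average over k. *)
Lemma exists_good_sample (T : finType) (Q : nat) (X : T -> 'I_Q -> R) :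
  (0 < Q)%N -> (0 < #|T|)%N ->
  (forall w, \sum_(k < Q) expR (X w k) <= Q%:R * expR 2) ->
  exists k, forall w, X w k <= 2 + ln #|T|%:R.
Proof.
move=> Q0 T0 HX; apply: contrapT => /forallNP H.
have T0' : (0 : R) < #|T|%:R by rewrite ltr0n.
have H1 k : expR 2 * #|T|%:R < \sum_w expR (X w k).
  have /existsNP[w /negP] := H k; rewrite -ltNge => Hw.
  rewrite (bigD1 w) //=; apply: (@lt_le_trans _ _ (expR (X w k))).
    by rewrite -{1}(@lnK _ #|T|%:R) // -expRD ltr_expR.
  by rewrite lerDl sumr_ge0 // => *; exact: expR_ge0.
have : \sum_(k < Q) expR 2 * #|T|%:R < \sum_(k < Q) \sum_w expR (X w k).
  apply: ltr_sum => //; apply/hasP.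
  by exists (Ordinal Q0); rewrite ?mem_index_enum.
rewrite exchange_big /= ltNge => /negP; apply.
apply: (@le_trans _ _ (\sum_(w : T) Q%:R * expR 2)); first exact: ler_sum.
rewrite !sumr_const card_ord -[leLHS]mulr_natr -[leRHS]mulr_natr.
by rewrite [leRHS]mulrC mulrA.
Qed.

Lemma cos_lipschitz (x y : R) : `|cos x - cos y| <= `|x - y|.
Proof.
wlog xy : x y / y <= x.
  move=> H; have [/H//|/ltW/H] := leP y x.
  by rewrite distrC (distrC y).
have dcos z : z \in `]y, x[ -> is_derive z 1 (@cos R) (- sin z).
  by move=> _; exact: is_derive_cos.
have [|c _ ->] := MVT_segment xy dcos.
  by apply: continuous_subspaceT => z; exact: continuous_cos.
by rewrite normrM normrN ler_piMl // sin_max.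
Qed.


Lemma superincreasing_class (kap : nat -> nat) (P : pred nat) (p : nat) :
  (forall j, P j -> (0 < kap j)%N) ->
  (forall i j, (i < j)%N -> (j < p)%N -> P i -> P j -> (2 * kap i <= kap j)%N) ->
  forall j, (j < p)%N -> P j -> (\sum_(i < j | P i) kap i < kap j)%N.
Proof.
move=> k0 k2.
suff H n j : (n <= j)%N -> (j < p)%N -> P j -> (\sum_(i < n | P i) kap i < kap j)%N.
  by move=> j jp Pj; apply: H.
elim: n j => [|n IH] j nj jp Pj; first by rewrite big_ord0 k0.
rewrite big_mkcond big_ord_recr -big_mkcond /=; case: ifP => Pn.
  have := IH n (leqnn _) (ltn_trans nj jp) Pn; have := k2 _ _ nj jp Pn Pj.
  by move: (\sum_(i < n | P i) kap i)%N => s; lia.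
by rewrite addn0; apply: IH => //; exact: ltnW.
Qed.

(** Addition formula; it removes a phase shared by all terms, such as the one that a common
    remainder of [theta] modulo m produces. *)
Lemma norm_cosD_le (I : finType) (P : pred I) (c be : I -> R) (phi B : R) :
  `|\sum_(i | P i) c i * cos (be i)| <= B ->
  `|\sum_(i | P i) c i * sin (be i)| <= B ->
  `|\sum_(i | P i) c i * cos (be i + phi)| <= 2 * B.
Proof.
move=> hc hs.
have -> : \sum_(i | P i) c i * cos (be i + phi) =
  cos phi * (\sum_(i | P i) c i * cos (be i)) - sin phi * (\sum_(i | P i) c i * sin (be i)).
  rewrite !mulr_sumr -sumrB; apply: eq_bigr => i _; rewrite cosD; ring.
apply: (le_trans (ler_normB _ _)); rewrite !normrM.
have := ler_pM (normr_ge0 _) (normr_ge0 _) (cos_max phi) hc.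
have := ler_pM (normr_ge0 _) (normr_ge0 _) (sin_max phi) hs.
lra.
Qed.

Lemma card_ord_lt (N m : nat) : (#|[pred i : 'I_N | (i < m)%N]| <= m)%N.
Proof.
rewrite -sum1_card; suff : (\sum_(i < N | (i < m)%N) 1 <= minn N m)%N.
  by move=> /leq_trans; apply; exact: geq_minr.
elim: N => [|N IH]; first by rewrite big_ord0.
rewrite big_mkcond big_ord_recr -big_mkcond /=.
by move: IH; move: (\sum_(i < N | (i < m)%N) 1)%N => s; case: ltnP; lia.
Qed.

(* The sample points are tstar + 2 pi k / (m Q): within a class modulo m of
   theta, the average over k behaves like an average over a full period, although
   all points lie within 2 pi / m of tstar. *)
Lemma random_phases (rho al : nat -> R) (theta : nat -> nat) (N q m V : nat)
    (mu D tstar : R) :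
  (0 < q)%N -> (0 < m)%N -> (0 < V)%N ->
  (forall n, 0 <= rho n) -> (forall n, (n < N)%N -> rho n <= mu) -> 0 <= mu ->
  0 < D -> \sum_(n < N) rho n ^+ 2 <= D ^+ 2 ->
  (forall n, (n < theta n)%N) ->
  (forall i j, (i + q <= j < N)%N -> (2 * theta i <= theta j)%N) ->
  exists t, `|t - tstar| <= 2 * pi / m%:R /\
   forall l j : nat, (l < V)%N ->
    `|\sum_(n < N) rho n * cos (al n + (theta n)%:R * t +
        n%:R * (2 * pi * l%:R / V%:R) + j%:R * (pi / 2))|
    <= m%:R * mu + 2 * (2 + ln (4 * q * m * V)%:R) * (D * Num.sqrt (q * m)%:R).
Proof.
move=> q0 m0 V0 rho0 rhomu mu0 D0 HD thn th2.
pose J := ('I_q * 'I_m)%type.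
(* Indices i < j of one class satisfy i + q <= j, hence 2 theta i <= theta j; as the remainders
   modulo m agree, the quotients [kap] at least double as well. *)
pose cl n : J := (Ordinal (ltn_pmod n q0), Ordinal (ltn_pmod (theta n) m0)).
(* Requiring m <= n makes [kap n] positive, as n < theta n; the indices below m contribute at most m
   mu. *)
pose P (c : J) (n : nat) := (m <= n)%N && (cl n == c).
pose kap n := (theta n %/ m)%N.
pose Q := ((\sum_(n < N) theta n).*2.+1)%N.
pose w : R := 2 * pi / Q%:R.
have qm0 : (0 : R) < (q * m)%:R by rewrite ltr0n muln_gt0 q0.
have V0' : (V%:R : R) != 0 by rewrite pnatr_eq0 -lt0n.
(* [sig c] below dominates sqrt (s c) by the arithmetic-geometric mean inequality and is positive
   even for an empty class. This [tau] makes the sum of all [sig c] at most D sqrt (q m). *)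
pose tau := D / Num.sqrt (q * m)%:R.
have tau0 : 0 < tau by rewrite divr_gt0 // sqrtr_gt0.
pose s (c : J) := \sum_(n < N | P c n) rho n ^+ 2.
have s0 c : 0 <= s c by apply: sumr_ge0 => *; exact: sqr_ge0.
pose sig c := (s c / tau + tau) / 2.
have sig0 c : 0 < sig c by rewrite divr_gt0 // ltr_wpDl // divr_ge0 // ltW.
have ssig c : s c <= sig c ^+ 2.
  rewrite -subr_ge0 (_ : _ - _ = ((s c / tau - tau) / 2) ^+ 2) ?sqr_ge0 //.
  by rewrite /sig; field; rewrite gt_eqF.
pose be (l j : nat) n := al n + (theta n)%:R * tstar +
        n%:R * (2 * pi * l%:R / V%:R) + j%:R * (pi / 2).
(* The index in ['I_4] turns the phase by multiples of pi / 2, so that upper bounds for cosine sums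
   also bound their absolute values and the sine sums. *)
pose X (o : 'I_q * 'I_m * 'I_V * 'I_4) (k : 'I_Q) :=
  \sum_(n < N | P o.1.1 n) rho n / sig o.1.1 *
     cos (k%:R * (kap n)%:R * w + be o.1.2 o.2 n).
have [k Hk] : exists k, forall o, X o k <= 2 + ln #|{: 'I_q * 'I_m * 'I_V * 'I_4}|%:R.
  apply: exists_good_sample => //.
    by rewrite !card_prod !card_ord !muln_gt0 q0 m0 V0.
  move=> [[c l] j].
  apply: (sum_expR_cos_le (fun n => rho n / sig c) (be l j) kap (P c)) => /=.
  - apply: superincreasing_class.
      move=> i /andP[mi _]; rewrite divn_gt0 //; exact: (leq_trans mi (ltnW (thn i))).
    move=> i j' ij jN /andP[mi /eqP ci] /andP[mj /eqP cj].
    move: ci; rewrite -cj => -[ciq cim].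
    have iqj : (i + q <= j')%N.
      have dv : (q %| j' - i)%N by rewrite -eqn_mod_dvd ?(ltnW ij) //; apply/eqP.
      by have := @dvdn_leq q (j' - i); rewrite subn_gt0 leq_subRL ?(ltnW ij) //; apply.
    have := th2 i j'; rewrite iqj jN => /(_ isT).
    rewrite (divn_eq (theta i) m) (divn_eq (theta j') m) cim -/(kap i) -/(kap j').
    move=> H; rewrite -(leq_pmul2r m0); move: H.
    by move: (kap i) (kap j') (theta j' %% m)%N => a b r; clear; lia.
  - move=> i iN _; rewrite /Q -[X in (_ <= X)%N]/(_.*2.+1) leqW // leq_double.
    rewrite (leq_trans (leq_div _ _)) //.
    by rewrite (bigD1 (Ordinal iN)) //= leq_addr.
  - under eq_bigr do rewrite expr_div_n.
    by rewrite -mulr_suml -/(s c) ler_pdivrMr ?exprn_gt0 // mul1r.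
rewrite !card_prod !card_ord (_ : (_ * _ * _ * 4)%N = (4 * q * m * V)%N) in Hk; last by lia.
set u := 2 + ln _ in Hk *.
(* Since theta n is m kap n plus a remainder, this shift changes the phase by k kap n w plus a term
   that depends only on the class. *)
pose t := tstar + k%:R * w / m%:R.
exists t; split.
  rewrite /t addrC addKr.
  have Q0 : (0 : R) < Q%:R by rewrite ltr0n.
  have p0 := @pi_gt0 R.
  have m0' : (0 : R) < m%:R by rewrite ltr0n.
  rewrite ger0_norm; last by rewrite !mulr_ge0 ?invr_ge0 // ltW.
  rewrite ler_wpM2r ?invr_ge0 ?ler0n // /w mulrCA ger_pMr ?mulr_gt0 //.
  by rewrite ler_pdivrMr // mul1r ler_nat ltnW.
have Hcos c (l j : nat) : (l < V)%N -> \sum_(n < N | P c n) rho n *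
     cos (k%:R * (kap n)%:R * w + be l j n) <= sig c * u.
  move=> lV.
  have j4 : (j %% 4 < 4)%N by rewrite ltn_mod.
  have := Hk (c, Ordinal lV, Ordinal j4); rewrite /X /=.
  under eq_bigr do rewrite mulrAC.
  rewrite -mulr_suml ler_pdivrMr // mulrC; apply: le_trans.
  rewrite le_eqVlt; apply/orP; left; apply/eqP; apply: eq_bigr => n _; congr (_ * _).
  rewrite {1}(divn_eq j 4) /be.
  set z := (X in cos (_ + X)); set z' := (X in _ = cos (_ + X)).
  have -> : z = z' + pi *+ 2 *+ (j %/ 4).
    by rewrite /z /z' natrD natrM -[pi *+ 2 *+ _]mulr_natr -(mulr_natr pi); field.
  by rewrite addrA (periodicn (@cosD2pi R)).
have Hncos c (l j : nat) : (l < V)%N -> `|\sum_(n < N | P c n) rho n *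
     cos (k%:R * (kap n)%:R * w + be l j n)| <= sig c * u.
  move=> lV; rewrite ler_norml Hcos // andbT lerNl.
  have := Hcos c l (j + 2)%N lV; apply: le_trans.
  rewrite le_eqVlt -sumrN; apply/orP; left; apply/eqP; apply: eq_bigr => n _.
  rewrite -mulrN -cosDpi /be natrD; by congr (_ * cos _); field.
have Hnsin c (l j : nat) : (l < V)%N -> `|\sum_(n < N | P c n) rho n *
     sin (k%:R * (kap n)%:R * w + be l j n)| <= sig c * u.
  move=> lV; have := Hncos c l j.+1 lV; apply: le_trans; rewrite -normrN -sumrN.
  rewrite le_eqVlt; apply/orP; left; apply/eqP; congr (`|_|); apply: eq_bigr => n _.
  rewrite -mulrN -cosDpihalf /be -natr1; by congr (_ * cos _); ring.
move=> l j lV; have u0 : 0 <= u.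
  by rewrite addr_ge0 // ln_ge0 // ler1n !muln_gt0 q0 m0 V0.
pose phi (c : J) : R := k%:R * w * (c.2 : nat)%:R / m%:R.
have m0' : (m%:R : R) != 0 by rewrite pnatr_eq0 -lt0n.
have Ephase n : al n + (theta n)%:R * t + n%:R * (2 * pi * l%:R / V%:R) + j%:R * (pi / 2)
   = (k%:R * (kap n)%:R * w + be l j n) + phi (cl n).
  have E : (theta n)%:R * (k%:R * w / m%:R) = k%:R * (kap n)%:R * w + phi (cl n).
    by rewrite {1}(divn_eq (theta n) m) natrD natrM /phi /=; field.
  by rewrite /t mulrDr E /be; ring.
under eq_bigr do rewrite Ephase.
set F := fun n : 'I_N => rho n * cos (k%:R * (kap n)%:R * w + be l j n + phi (cl n)).
rewrite (bigID (fun n : 'I_N => (n < m)%N)) /=.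
apply: (le_trans (ler_normD _ _)); apply: lerD.
  apply: (le_trans (ler_norm_sum _ _ _)).
  apply: (@le_trans _ _ (\sum_(n < N | (n < m)%N) mu)).
    apply: ler_sum => n _; rewrite normrM ger0_norm // -[leRHS]mulr1.
    by apply: ler_pM => //; [exact: rhomu|exact: cos_max].
  rewrite sumr_const -[leLHS]mulr_natl ler_wpM2r // ler_nat.
  exact: card_ord_lt.
rewrite (partition_big (fun n : 'I_N => cl n) xpredT) //=.
apply: (le_trans (ler_norm_sum _ _ _)).
apply: (@le_trans _ _ (\sum_(c : J) 2 * (sig c * u))).
  apply: ler_sum => c _.
  have E (G : 'I_N -> R) :
    \sum_(n < N | ~~ (n < m)%N && (cl n == c)) G n = \sum_(n < N | P c n) G n.
    by apply: eq_bigl => n; rewrite -leqNgt.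
  rewrite E (eq_bigr (fun n : 'I_N => rho n *
    cos (k%:R * (kap n)%:R * w + be l j n + phi c))); last first.
    by move=> n /andP[_ /eqP <-].
  by apply: norm_cosD_le; [exact: Hncos|exact: Hnsin].
have -> : \sum_(c : J) 2 * (sig c * u) = 2 * u * \sum_(c : J) sig c.
  by rewrite mulr_sumr; apply: eq_bigr => c _; ring.
rewrite ler_wpM2l ?mulr_ge0 //.
have Ss : \sum_c s c <= D ^+ 2.
  apply: le_trans HD; rewrite [leRHS](bigID (fun n : 'I_N => (n < m)%N)) /=.
  rewrite -[leLHS]add0r lerD //; first by apply: sumr_ge0 => *; exact: sqr_ge0.
  rewrite [leRHS](partition_big (fun n : 'I_N => cl n) xpredT) //=.
  apply: ler_sum => c _; rewrite /s.
  rewrite le_eqVlt; apply/orP; left; apply/eqP.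
  by apply: eq_bigl => n; rewrite -leqNgt.
rewrite /sig -mulr_suml big_split /= -mulr_suml sumr_const card_prod !card_ord.
rewrite -[X in (_ + X) / 2]mulr_natl ler_pdivrMr //.
have sq0 : 0 < Num.sqrt ((q * m)%:R : R) by rewrite sqrtr_gt0.
apply: (@le_trans _ _ (D ^+ 2 / tau + (q * m)%:R * tau)).
  by rewrite lerD2r ler_wpM2r // invr_ge0 ltW.
rewrite /tau; have := sqr_sqrtr (ltW qm0).
move: (Num.sqrt _) sq0 => r r0 <-.
rewrite le_eqVlt; apply/orP; left; apply/eqP; field.
by rewrite !gt_eqF.
Qed.

End RandomPhases.

(** * Concentration of positive power series *)

Section Concentration.
Context {R : realType}.

(** Borel's argument: if the last inequality failed near 0, each move from x to x (1 - g(x)^(-eps))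
    would more than double g. The moves would then be dominated by a geometric series and stay to
    the left of x1 / 2, where g is bounded by g(x1 / 2). *)
Lemma growth_regular (g : R -> R) (eps x0 Gam : R) :
  (forall x y, x <= y -> y < 0 -> g x <= g y) ->
  (forall C, exists2 x1, x1 < 0 & forall x, x1 <= x -> x < 0 -> C <= g x) ->
  0 < eps -> x0 < 0 ->
  exists x, [/\ x0 <= x, x < 0, Gam <= g x & g (x * (1 - g x `^ (- eps))) <= 2 * g x].
Proof.
move=> gmono ginf eps0 x00.
(* The sum of the geometric series of ratio 2^(-eps), by which the factor g^(-eps) shrinks at
   least. *)
pose k : R := (1 - 2 `^ (- eps))^-1.
have p2 : 2 `^ (- eps) < 1 :> R.
  rewrite powRN invf_lt1 ?powR_gt0 //.
  by have := @gt0_ltr_powR R eps eps0 1 2; rewrite powR1; apply; rewrite ?nnegrE ?ltr1n.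
have k0 : 0 < k by rewrite invr_gt0 subr_gt0.
pose C := Num.max (Num.max Gam 1) ((2 * k) `^ eps^-1).
have [x2 x20 Hx2] := ginf C.
pose x1 := Num.max x0 x2.
have x10 : x1 < 0 by rewrite gt_max x00.
have HC x : x1 <= x -> x < 0 -> [/\ Gam <= g x, 1 <= g x & k * g x `^ (- eps) <= 1 / 2].
  rewrite ge_max => /andP[_ x2x] xlt; have := Hx2 x x2x xlt.
  rewrite !ge_max => /andP[/andP[h1 h2] h3]; split => //.
  have k2 : 0 < 2 * k by rewrite mulr_gt0.
  have h4 : 2 * k <= g x `^ eps.
    have e : ((2 * k) `^ eps^-1) `^ eps = 2 * k.
      by rewrite -powRrM mulVf ?gt_eqF // powRr1 // ltW.
    rewrite -{1}e; apply: ge0_ler_powR; rewrite ?nnegrE ?powR_ge0 //; first exact: ltW.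
    exact: le_trans h2.
  have h5 : 0 < g x `^ eps by apply: lt_le_trans h4.
  by rewrite powRN ler_pdivrMr //; lra.
apply: contrapT => Hno.
have Hgrow x : x1 <= x -> x < 0 -> 2 * g x < g (x * (1 - g x `^ (- eps))).
  move=> xx x0'; rewrite ltNge; apply/negP => H; apply: Hno; exists x.
  have [? ? ?] := HC x xx x0'; split => //.
  by apply: le_trans xx; rewrite le_max lexx.
(* In units of |x1|, the term k g(x)^(-eps) bounds the displacement still to come, so no iterate
   passes x1 / 2. *)
have Hseq (j : nat) : exists x, [/\ x1 <= x,
    x <= x1 * (1 / 2 + k * g x `^ (- eps)) & 2 ^+ j * g x1 <= g x].
  elim: j => [|j [x [x1x xle gx]]].
    have [_ _ h] := HC x1 (lexx _) x10.
    by exists x1; split; rewrite ?expr0 ?mul1r //; nra.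
  have p0 : 0 <= g x `^ (- eps) by apply: powR_ge0.
  have xneg : x < 0.
    apply: le_lt_trans xle _; rewrite nmulr_rlt0 //.
    by have : 0 <= k * g x `^ (- eps) by [rewrite mulr_ge0 // ltW]; lra.
  have [_ g1 kp] := HC x x1x xneg.
  have gr := Hgrow x x1x xneg.
  set p := g x `^ (- eps) in xle p0 kp gr *.
  set x' := x * (1 - p) in gr *.
  have xx' : x <= x' by rewrite /x'; nra.
  exists x'; split; first exact: le_trans xx'.
    set p' := g x' `^ (- eps).
    have pp' : p' <= 2 `^ (- eps) * p.
      have g0 : 0 < g x by apply: lt_le_trans g1.
      have g20 : 0 < 2 * g x by rewrite mulr_gt0.
      have g'0 : 0 < g x' by apply: lt_trans gr.
      rewrite /p' /p !powRN -invfM -powRM //; last exact: ltW.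
      rewrite lef_pV2 ?posrE ?powR_gt0 //.
      by apply: ge0_ler_powR; rewrite ?nnegrE; lra.
    have kk : k * (1 - 2 `^ (- eps)) = 1 by rewrite mulVf // subr_eq0 gt_eqF.
    have kp' : k * p' <= k * p - p.
      have : k * p' <= k * (2 `^ (- eps) * p) by rewrite ler_wpM2l // ltW.
      have : (k * (1 - 2 `^ (- eps))) * p = 1 * p by rewrite kk.
      lra.
    have : x1 * (1 / 2 + k * p - p) <= x1 * (1 / 2 + k * p').
      by rewrite ler_wnM2l //; [exact: ltW|lra].
    have : x1 * p <= x * p by rewrite ler_wpM2r.
    rewrite /x'; lra.
  by rewrite exprS; lra.
have [_ g1 _] := HC x1 (lexx _) x10.
have x12 : x1 / 2 < 0 by rewrite pmulr_llt0.
pose j := Num.trunc (g (x1 / 2)).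
have [x [x1x xle gx]] := Hseq j.+1.
have xx : x <= x1 / 2.
  apply: (le_trans xle); rewrite ler_wnM2l ?(ltW x10) //.
  have : 0 <= k * g x `^ (- eps) by rewrite mulr_ge0 ?powR_ge0 // ltW.
  lra.
have := gmono _ _ xx x12.
have : (j.+1%:R : R) <= 2 ^+ j.+1 by rewrite -natrX ler_nat ltnW // ltn_expl.
have := truncnS_gt (g (x1 / 2)); rewrite -/j.
have : (2 ^+ j.+1 : R) <= 2 ^+ j.+1 * g x1 by rewrite ler_peMr ?exprn_ge0.
lra.
Qed.

(** Used contrapositively: an increment below this quadratic bound forces some second difference to
    be at most 1. *)
Lemma second_difference (u : nat -> R) (K : nat) :
  u 0%N <= u 1%N -> (forall k, (k.+1 < K)%N -> 1 < u k.+2 + u k - 2 * u k.+1) ->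
  K%:R * (K%:R - 1) / 2 <= u K - u 0%N.
Proof.
move=> u01 Hu.
have H1 k : (k < K)%N -> k%:R <= u k.+1 - u k.
  elim: k => [|k IH] kK; first by rewrite subr_ge0.
  have := Hu k kK; have := IH (ltnW kK); rewrite -[k.+1%:R]natr1; lra.
have H2 k : (k <= K)%N -> k%:R * (k%:R - 1) / 2 <= u k - u 0%N.
  elim: k => [|k IH] kK; first by rewrite !mul0r subrr.
  have := H1 k kK; have := IH (ltnW kK); rewrite -[k.+1%:R]natr1; lra.
exact: H2.
Qed.

(** This constant lets the two tails in [psup_le_max_term] take up at most half of the sum. *)
Lemma expRN3_mul_sqrt_e : expR (-3) * expR 2^-1 <= 4^-1 :> R.
Proof.
rewrite -expRD (_ : -3 + 2^-1 = - (2%:R * (5 / 4))); last by field.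
rewrite expRN expRM_natl lef_pV2 ?posrE ?exprn_gt0 ?expR_gt0 //.
have : (9 / 4 : R) <= expR (5 / 4) by have := expR_ge1Dx (5 / 4 : R); lra.
by nra.
Qed.

Lemma expR_shift_le (P Q u v k : R) : P = expR u -> Q = expR v ->
  k + u <= 2^-1 + v -> expR k * P <= expR 2^-1 * Q.
Proof. by move=> -> -> h; rewrite -!expRD ler_expR. Qed.

Section PositiveSeries.
Variable A : nat -> R.
Hypothesis A1 : forall n, 1 <= A n.
Hypothesis Abnd : forall x, x < 0 ->
  exists C, forall M, \sum_(n < M) A n * expR (n%:R * x) <= C.

Definition psum (x : R) (M : nat) : R := \sum_(n < M) A n * expR (n%:R * x).
(** The terms are nonnegative, so for x < 0 this supremum is the sum of the series at e^x. *)
Definition psup (x : R) : R := sup (range (psum x)).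
Local Notation g x := (ln (psup x)).

Let A0 n : 0 <= A n. Proof. exact: le_trans ler01 (A1 n). Qed.

Lemma psum_le_psup {x : R} M : x < 0 -> psum x M <= psup x.
Proof.
move=> /Abnd[C HC]; apply: ub_le_sup; last by exists M.
by exists C => _ [m _ <-]; exact: HC.
Qed.

Lemma psup_le (x C : R) : (forall M, psum x M <= C) -> psup x <= C.
Proof.
move=> HC; apply: ge_sup; first by exists (psum x 0), 0%N.
by move=> _ [m _ <-]; exact: HC.
Qed.

Local Opaque psup.

Lemma le_psup (x y : R) : x <= y -> y < 0 -> psup x <= psup y.
Proof.
move=> xy y0; apply: psup_le => M; apply: (le_trans _ (psum_le_psup M y0)).
by apply: ler_sum => n _; rewrite ler_wpM2l // ler_expR ler_wpM2l.
Qed.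

Lemma psup_ge1 {x : R} : x < 0 -> 1 <= psup x.
Proof.
move=> x0; apply: (le_trans _ (psum_le_psup 1 x0)).
by rewrite /psum big_ord1 mul0r expR0 mulr1.
Qed.

Lemma psup_gt0 {x : R} : x < 0 -> 0 < psup x.
Proof. by move=> /psup_ge1; apply: lt_le_trans. Qed.

Lemma psupE {x : R} : x < 0 -> psup x = expR (g x).
Proof. by move=> x0; rewrite lnK // posrE psup_gt0. Qed.

(** As the coefficients are at least 1, the first M + 1 terms are each at least 1/2 once x >= -1 /
    (2 (M + 1)). *)
Lemma psup_unbounded (C : R) :
  exists2 x1, x1 < 0 & forall x, x1 <= x -> x < 0 -> C <= psup x.
Proof.
have [M HM] : exists M : nat, C <= M.+1%:R / 2.
  exists (Num.trunc (2 * `|C|)).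
  have := truncnS_gt (2 * `|C|); have := ler_norm C; lra.
exists (- (2 * M.+1%:R)^-1); first by rewrite oppr_lt0 invr_gt0 mulr_gt0.
move=> x xge x0; apply: (le_trans HM); apply: (le_trans _ (psum_le_psup M.+1 x0)).
have -> : M.+1%:R / 2 = \sum_(n < M.+1) (1 / 2 : R).
  by rewrite sumr_const card_ord -[RHS]mulr_natr mulrC mul1r.
apply: ler_sum => n _; apply: (@le_trans _ _ (1 * expR (n%:R * x))); last first.
  by rewrite ler_wpM2r ?expR_ge0.
rewrite !mul1r; apply: (le_trans _ (expR_ge1Dx _)).
have h : - 2^-1 <= M.+1%:R * x.
  have M0 : (0 : R) < M.+1%:R by [].
  by rewrite mulrC -ler_pdivrMr // mulNr -invfM.
have : M.+1%:R * x <= n%:R * x by rewrite ler_wnM2r ?(ltW x0) // ler_nat ltnW.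
lra.
Qed.

(* Summed over n, the increments of this clamp function bound the number of
   integers in an interval of length l by l + 1. *)
Lemma clamp_step (a : R) {l} (x : R) : 0 <= l ->
  let psi y := Num.min (Num.max (y - a) 0) (l + 1) in
  0 <= psi (x + 1) - psi x /\ (a <= x <= a + l -> psi (x + 1) - psi x = 1).
Proof.
move=> l0 psi.
have E y : psi y = if y - a < 0 then 0 else if y - a < l + 1 then y - a else l + 1.
  have l1 : 0 < l + 1 by lra.
  rewrite /psi maxElt minElt; case: (ltP (y - a) 0) => //= _; by rewrite l1.
rewrite !E; split=> [|/andP[]].
  case: (ltP (x + 1 - a) 0) => h1; case: (ltP (x - a) 0) => h2;
  case: (ltP (x + 1 - a) (l + 1)) => h3; case: (ltP (x - a) (l + 1)) => h4; lra.
case: (ltP (x + 1 - a) 0) => [?|_]; first lra.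
case: (ltP (x - a) 0) => [?|_]; first lra.
by case: (ltP (x + 1 - a) (l + 1)) => ?; case: (ltP (x - a) (l + 1)) => ?; lra.
Qed.

(** Exponential form of Chebyshev's inequality: the right-hand side dominates the indicator of the
    complement of the window, and its sums against the weights are values of [psup] at y + d and y -
    d. *)
Lemma far_weight_ge1 (d b z : R) : 0 < d -> ~~ (b - 3 / d <= z <= b + 3 / d) ->
  1 <= expR (d * (z - b) - 3) + expR (d * (b - z) - 3).
Proof.
move=> d0; rewrite negb_and -!ltNge.
have h u : 3 / d < u -> 1 <= expR (d * u - 3).
  rewrite ltr_pdivrMr // mulrC => du.
  by apply: (le_trans _ (expR_ge1Dx _)); lra.
case/orP => far.
- by rewrite -[leLHS]add0r lerD ?expR_ge0 // h //; lra.
- by rewrite -[leLHS]addr0 lerD ?expR_ge0 // h //; lra.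
Qed.

(** Centring at the symmetric difference quotient b makes both left-hand sides equal to (p + m) /
    2. *)
Lemma midpoint_bounds {d p m c : R} : 0 < d -> p + m - 2 * c <= 1 ->
  let b := (p - m) / (2 * d) in
  - (d * b) + p <= 2^-1 + c /\ d * b + m <= 2^-1 + c.
Proof.
move=> d0 H b; have -> : d * b = (p - m) / 2 by rewrite /b; field; rewrite gt_eqF.
by split; lra.
Qed.

(** A window of half-width 3 / d around b holds at most 6 / d + 1 indices, each with a term at most
    mu. The terms outside sum to at most 2 e^(-3) e^(1/2) [psup y], which is absorbed on the
    left. *)
Lemma psup_le_max_term (y d mu : R) : 0 < d -> y + d < 0 ->
  g (y + d) + g (y - d) - 2 * g y <= 1 ->
  (forall n, A n * expR (n%:R * y) <= mu) ->
  psup y <= 2 * mu * (6 / d + 1).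
Proof.
move=> d0 yd0 Hd Hmu.
have y0 : y < 0 by rewrite (lt_trans _ yd0) // ltrDl.
have yd' : y - d < 0 by rewrite subr_lt0 (lt_trans y0).
have mu0 : 0 <= mu by apply: le_trans (Hmu 0%N); rewrite mulr_ge0 ?expR_ge0.
pose b := (g (y + d) - g (y - d)) / (2 * d).
pose a := b - 3 / d.
pose psi z := Num.min (Num.max (z - a) 0) (6 / d + 1).
have l0 : 0 <= 6 / d by rewrite divr_ge0 // ltW.
have d3 : 0 < 3 / d by rewrite divr_gt0.
pose w n := A n * expR (n%:R * y).
have w0 n : 0 <= w n by rewrite mulr_ge0 ?expR_ge0.
have Hw n : w n <= mu * (psi n.+1%:R - psi n%:R) +
   expR (-3) * (expR (- (d * b)) * (A n * expR (n%:R * (y + d))) +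
                expR (d * b) * (A n * expR (n%:R * (y - d)))).
  have -> : expR (-3) * (expR (- (d * b)) * (A n * expR (n%:R * (y + d))) +
                expR (d * b) * (A n * expR (n%:R * (y - d)))) =
     w n * (expR (d * (n%:R - b) - 3) + expR (d * (b - n%:R) - 3)).
    have -> : d * (n%:R - b) - 3 = -3 + - (d * b) + n%:R * d by ring.
    have -> : d * (b - n%:R) - 3 = -3 + (d * b) + n%:R * (- d) by ring.
    rewrite /w !mulrDr !expRD; ring.
  have [psi0 psi1] := clamp_step a n%:R l0; rewrite -/psi natr1 in psi0 psi1.
  have [ina|far] := boolP (a <= n%:R <= a + 6 / d).
    rewrite (psi1 ina) mulr1; apply: (le_trans (Hmu n)).
    by rewrite lerDl mulr_ge0 ?addr_ge0 ?expR_ge0.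
  rewrite -[leLHS]add0r; apply: lerD; first by rewrite mulr_ge0.
  rewrite -[leLHS]mulr1 ler_wpM2l //; apply: far_weight_ge1 => //.
  apply: contra far => near; rewrite /a (_ : b - _ + 6 / d = b + 3 / d) //.
  by field; rewrite gt_eqF.
have e52 := expRN3_mul_sqrt_e.
have [bp bm] := midpoint_bounds d0 Hd; rewrite -/b in bp bm.
have eG1 : expR (- (d * b)) * psup (y + d) <= expR 2^-1 * psup y.
  exact: expR_shift_le (psupE yd0) (psupE y0) bp.
have eG2 : expR (d * b) * psup (y - d) <= expR 2^-1 * psup y.
  exact: expR_shift_le (psupE yd') (psupE y0) bm.
suff : psup y <= mu * (6 / d + 1) + psup y / 2.
  by move: (psup y) (6 / d + 1) => p e; clear; lra.
apply: psup_le => M.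
apply: le_trans; first by apply: ler_sum => n _; exact: Hw.
rewrite big_split /= -[X in X + _]mulr_sumr -[X in _ + X]mulr_sumr.
have -> : \sum_(n < M) (psi n.+1%:R - psi n%:R) = psi M%:R - psi 0%:R.
  by rewrite -(telescope_sumr (fun n => psi n%:R)) // big_mkord.
rewrite big_split /= -!mulr_sumr.
apply: lerD.
  rewrite ler_wpM2l //.
  have psiM : psi M%:R <= 6 / d + 1 by rewrite ge_min lexx orbT.
  have psi0 : 0 <= psi 0%:R by rewrite le_min le_max lexx orbT addr_ge0.
  by rewrite lerBlDr (le_trans psiM) // lerDl.
have h1 : expR (- (d * b)) * psum (y + d) M <= expR 2^-1 * psup y.
  by apply: (le_trans _ eG1); rewrite ler_wpM2l ?expR_ge0 // psum_le_psup.
have h2 : expR (d * b) * psum (y - d) M <= expR 2^-1 * psup y.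
  by apply: (le_trans _ eG2); rewrite ler_wpM2l ?expR_ge0 // psum_le_psup.
apply: (@le_trans _ _ (expR (-3) * (2 * (expR 2^-1 * psup y)))).
  by rewrite ler_wpM2l ?expR_ge0 //; rewrite mulrDl mul1r lerD.
have := ltW (psup_gt0 y0) => py.
rewrite mulrCA (_ : psup y / 2 = 2 * (4^-1 * psup y)); last by field.
by rewrite ler_wpM2l // mulrA ler_wpM2r.
Qed.

End PositiveSeries.
End Concentration.

(** * Comparison of the sum with the maximal term at a suitable radius *)

Section WimanValiron.
Context {R : realType}.
Section SupBounds.
Variable A : nat -> R.
Hypothesis A1 : forall n, 1 <= A n.
Hypothesis Abnd : forall x, x < 0 ->
  exists C, forall M, \sum_(n < M) A n * expR (n%:R * x) <= C.
Local Notation g x := (ln (psup A x)).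

Local Opaque psup.

Lemma ln_psup_mono x y : x <= y -> y < 0 -> g x <= g y.
Proof.
move=> xy y0; rewrite ler_ln ?posrE ?psup_gt0 //; first exact: le_psup.
exact: le_lt_trans y0.
Qed.

Lemma ln_psup_unbounded C :
  exists2 x1, x1 < 0 & forall x, x1 <= x -> x < 0 -> C <= g x.
Proof.
have [x1 x10 H] := psup_unbounded A A1 Abnd (expR C); exists x1 => // x x1x x0.
by rewrite -[leLHS]expRK ler_ln ?posrE ?expR_gt0 ?psup_gt0 // H.
Qed.

(** For n >= N a shift of y by s gains the factor e^(-N s), which outweighs the whole sum at y + s,
    at most e^(2 gam). *)
Lemma tail_le (y s gam : R) (N M : nat) : 0 < s -> y + s < 0 ->
  g (y + s) <= 2 * gam -> 2 * gam <= N%:R * s ->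
  \sum_(n < M | (N <= n)%N) A n * expR (n%:R * y) <= 1.
Proof.
move=> s0 ys gys Ns.
apply: (@le_trans _ _ (\sum_(n < M) expR (- (N%:R * s)) * (A n * expR (n%:R * (y + s))))).
  rewrite big_mkcond /=; apply: ler_sum => n _; case: ifP => [Nn|_]; last first.
    by rewrite !mulr_ge0 ?expR_ge0 // (le_trans ler01).
  rewrite mulrCA ler_wpM2l ?(le_trans ler01) // -expRD ler_expR.
  rewrite mulrDr addrCA lerDl addrC subr_ge0 ler_wpM2r ?(ltW s0) // ler_nat //.
rewrite -mulr_sumr.
apply: (@le_trans _ _ (expR (- (N%:R * s)) * expR (2 * gam))).
  rewrite ler_wpM2l ?expR_ge0 //; apply: (le_trans (psum_le_psup A Abnd M ys)).
  by rewrite (psupE A A1 Abnd ys) ler_expR.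
by rewrite -expRD expR_le1 addrC subr_le0.
Qed.

End SupBounds.

(** [growth_regular] keeps g below 2 gam up to x (1 - p) with p = gam^(-eps). Half of this interval
    is cut into K steps, with K of order sqrt gam; were all second differences above 1, g would grow
    by more than gam. The other half is the shift used in [tail_le]. *)
Lemma wiman_valiron (A : nat -> R) (A1 : forall n, 1 <= A n)
    (Abnd : forall x, x < 0 ->
      exists C, forall M, \sum_(n < M) A n * expR (n%:R * x) <= C)
    (eps x0 Gam : R) : 0 < eps -> x0 < 0 ->
  exists y gam, [/\ x0 <= y < 0, Gam <= gam, gam <= ln (psup A y),
    forall mu, (forall n, A n * expR (n%:R * y) <= mu) ->
      psup A y <= 84 * mu * (gam `^ (2^-1 + eps) / - y) &
    forall N M : nat, 4 * gam `^ (1 + eps) / - y <= N%:R ->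
      \sum_(n < M | (N <= n)%N) A n * expR (n%:R * y) <= 1].
Proof.
move=> eps0 x00.
(* The bound -1 on the left ensures d <= 1; the bound 4 <= gam in the next line ensures K <= 3 sqrt
   gam. *)
have x1neg : Num.max x0 (-1) < 0 by rewrite gt_max x00 ltrN10.
have [x [] ] := growth_regular _ _ _ (Num.max Gam 4) (ln_psup_mono A A1 Abnd) (ln_psup_unbounded A A1 Abnd) eps0 x1neg.
set gam := ln (psup A x).
rewrite !ge_max => /andP[x0x xN1] xneg /andP[Gg g4] greg.
set p := gam `^ (- eps) in greg.
have g0 : 0 < gam by apply: lt_le_trans g4.
have gne : gam != 0 by rewrite gt_eqF.
have p0 : 0 < p by apply: powR_gt0.
have p1' : p < 1.
  rewrite /p powRN invf_lt1 ?powR_gt0 //.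
  have : 1 `^ eps < gam `^ eps by apply: gt0_ltr_powR; rewrite ?nnegrE // ?(ltW g0) //; clear -g4; lra.
  by rewrite powR1.
have p1 := ltW p1'.
have xp' : x * (1 - p) < 0 by rewrite pmulr_llt0 // subr_gt0.
have pV : p^-1 = gam `^ eps by rewrite /p powRN invrK.
pose r := Num.sqrt gam.
have rr : r * r = gam by rewrite -expr2 sqr_sqrtr // ltW.
have r2 : 2 <= r.
  rewrite -(@ler_pXn2r _ 2) ?nnegrE ?sqrtr_ge0 // expr2 [leRHS]expr2 rr.
  by apply: le_trans g4; rewrite -natrM.
pose K := (Num.trunc (2 * r)).+2.
have K1 : 2 * r + 1 < K%:R by have := truncnS_gt (2 * r); rewrite /K -[_.+2%:R]natr1; lra.
have K3 : K%:R <= 3 * r.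
  have := @truncn_le _ (2 * r); have -> : 0 <= 2 * r by lra.
  by rewrite /K -[_.+2%:R]natr1 -[_.+1%:R]natr1; lra.
have K0 : 0 < K%:R :> R by lra.
pose d := - x * p / (2 * K%:R).
have nx : 0 < - x by rewrite oppr_gt0.
have d0 : 0 < d by rewrite divr_gt0 ?mulr_gt0.
have Kne : (K%:R : R) != 0 by rewrite gt_eqF.
have pne : p != 0 by rewrite gt_eqF.
have xne : x != 0 by rewrite lt_eqF.
have Kd : K%:R * d = - x * p / 2 by rewrite /d; field.
have xp : - x * p <= - x by rewrite ger_pMr.
have xp0 : 0 < - x * p by rewrite mulr_gt0.
have kd k : (k <= K)%N -> k%:R * d <= - x * p / 2.
  by move=> kK; rewrite -Kd ler_wpM2r ?(ltW d0) // ler_nat.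
have kneg k : (k <= K)%N -> x + k%:R * d < 0.
  by move=> /kd; move: (k%:R * d) => z; lra.
pose u k := ln (psup A (x + k%:R * d)).
have [k kK Hk] : exists2 k, (k.+1 < K)%N & u k.+2 + u k - 2 * u k.+1 <= 1.
  apply: contrapT => H.
  have H1 : u 0%N <= u 1%N.
    apply: (ln_psup_mono A A1 Abnd); first by rewrite mul0r mul1r lerD2l ltW.
    exact: kneg.
  have H2 k : (k.+1 < K)%N -> 1 < u k.+2 + u k - 2 * u k.+1.
    by move=> kK; rewrite ltNge; apply/negP => h; apply: H; exists k.
  have := second_difference _ _ H1 H2.
  have -> : u 0%N = gam by rewrite /u mul0r addr0.
  have : u K <= 2 * gam.
    apply: le_trans greg; apply: (ln_psup_mono A A1 Abnd); rewrite ?Kd.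
      by rewrite mulrBr mulr1; clear -xp0; lra.
    exact: xp'.
  have : 2 * gam < K%:R * (K%:R - 1) / 2.
    have h : 0 < (K%:R - 2 * r - 1) * (K%:R + 2 * r) by apply: mulr_gt0; clear -K1 r2; lra.
    by rewrite -rr; clear -h r2; lra.
  by clear -g0; lra.
pose y := x + k.+1%:R * d.
have kd1 : k.+1%:R * d <= - x * p / 2 by apply: kd; exact: ltnW.
have kd0 : 0 < k.+1%:R * d by rewrite mulr_gt0.
have xy : x <= y by rewrite /y lerDl ltW.
have yneg : y < 0 by apply: kneg; exact: ltnW.
have ny : 0 < - y by rewrite oppr_gt0.
have yx : (- x)^-1 <= (- y)^-1 by rewrite lef_pV2 ?posrE // lerN2.
exists y, gam; split.
- by rewrite yneg andbT (le_trans x0x).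
- exact: Gg.
- exact: (ln_psup_mono A A1 Abnd).
- move=> mu Hmu.
  have mu0 : 0 <= mu.
    by apply: (le_trans _ (Hmu 0%N)); rewrite mulr_ge0 ?expR_ge0 // (le_trans ler01).
  have ydE : y + d = x + k.+2%:R * d by rewrite /y -[k.+2%:R]natr1; ring.
  have := @psup_le_max_term _ A A1 Abnd y d mu d0; rewrite ydE.
  have -> : y - d = x + k%:R * d by rewrite /y -[k.+1%:R]natr1; ring.
  move=> /(_ (kneg _ kK) Hk Hmu) /le_trans; apply.
  (* The factor 6 comes from 2 K <= 6 sqrt gam. As d <= 1 gives 6 / d + 1 <= 7 / d, the final
     constant is 84 = 2 * 7 * 6. *)
  have dV : d^-1 <= 6 * (gam `^ (2^-1 + eps) / - y).
    have -> : d^-1 = 2 * K%:R * p^-1 * (- x)^-1 by rewrite /d; field; rewrite xne Kne pne.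
    rewrite pV powRD ?gne ?implybT // powR12_sqrt ?(ltW g0) // -/r.
    rewrite !mulrA ler_pM ?invr_ge0 ?mulr_ge0 ?powR_ge0 ?(ltW K0) ?(ltW nx) //.
    by rewrite ler_wpM2r ?powR_ge0 //; clear -K3; lra.
  have d1 : 1 <= d^-1.
    rewrite invf_ge1 // /d ler_pdivrMr ?mulr_gt0 // mul1r.
    by apply: (le_trans xp); clear -xN1 K1 r2; lra.
  rewrite -mulrA (_ : 84 * mu * _ = 2 * (mu * (42 * (gam `^ (2^-1 + eps) / - y)))); last by ring.
  by rewrite ler_wpM2l // ler_wpM2l //; clear -dV d1; lra.
- move=> N M HN; pose s := - x * p / 2.
  have s0 : 0 < s by rewrite divr_gt0.
  have ys : y + s <= x * (1 - p) by rewrite /y /s; clear -kd1; lra.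
  apply: (@tail_le A A1 Abnd y s gam N M s0).
  + exact: le_lt_trans xp'.
  + exact: (le_trans (ln_psup_mono A A1 Abnd _ _ ys xp') greg).
  have -> : 2 * gam = 4 * gam `^ (1 + eps) / - x * s.
    rewrite powRD ?gne ?implybT // powRr1 ?(ltW g0) // -pV /s.
    by field; rewrite xne pne.
  rewrite ler_wpM2r ?(ltW s0) //; apply: le_trans HN.
  by rewrite ler_wpM2l // mulr_ge0 ?powR_ge0.
Qed.

End WimanValiron.

(** * Complex power series *)

Section ComplexLayer.
Context {R : realType}.
Implicit Types (z : R[i]) (x y : R).
Import ComplexField.Normc.

Lemma cmod0 : cmod (0 : R[i]) = 0. Proof. exact: normc0. Qed.
Lemma cmodM z1 z2 : cmod (z1 * z2) = cmod z1 * cmod z2. Proof. exact: normcM. Qed.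
Lemma cmod_ge0 z : 0 <= cmod z.
Proof. by case: z => a b; rewrite /cmod /normc sqrtr_ge0. Qed.
Lemma cmodD z1 z2 : cmod (z1 + z2) <= cmod z1 + cmod z2.
Proof. exact: le_normcD. Qed.
Lemma cmodX z n : cmod (z ^+ n) = cmod z ^+ n.
Proof. by elim: n => [|n IH]; rewrite ?expr0 ?exprS ?cmodM ?IH //; exact: normc1. Qed.
Lemma cmod_cis x : cmod (cis x) = 1.
Proof. by rewrite /cmod /cis /normc cos2Dsin2 sqrtr1. Qed.
Lemma cmod_sum (I : Type) (s : seq I) (P : pred I) (F : I -> R[i]) :
  cmod (\sum_(i <- s | P i) F i) <= \sum_(i <- s | P i) cmod (F i).
Proof.
elim/big_rec2: _ => [|i x z _ H]; first by rewrite cmod0.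
by apply: (le_trans (cmodD _ _)); rewrite lerD2l.
Qed.

Lemma cmodE z : (cmod z)%:C%C = `|z| :> R[i].
Proof. by []. Qed.

Lemma cisD x y : cis (x + y) = cis x * cis y.
Proof. rewrite /cis sinD cosD; simpc; congr (_ +i* _)%C; ring. Qed.

Lemma cisX x n : cis x ^+ n = cis (n%:R * x).
Proof.
elim: n => [|n IH]; first by rewrite mul0r /cis cos0 sin0.
by rewrite exprS IH -cisD -natr1; congr cis; ring.
Qed.

Lemma cmod_le_ReIm z (B : R) : `|complex.Re z| <= B -> `|complex.Im z| <= B -> cmod z <= 2 * B.
Proof.
case: z => a b ha hb; rewrite (_ : (a +i* b)%C = a%:C%C + (0 +i* b)%C).
  apply: (le_trans (cmodD _ _)).
  move: ha hb; rewrite /cmod /normc /= !expr0n /= addr0 add0r !sqrtr_sqr; lra.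
by simpc.
Qed.

Lemma polar z : exists al, [/\ 0 <= al, al <= 2 * pi & z = (cmod z)%:C%C * cis al].
Proof.
have [->|z0] := eqVneq z 0.
  exists 0; split => //; first by rewrite mulr_ge0 ?pi_ge0.
  by rewrite cmod0 mul0r.
have m0 : 0 < cmod z.
  rewrite lt_neqAle cmod_ge0 andbT eq_sym; apply/eqP => /eq0_normc zE.
  by rewrite zE eqxx in z0.
case: z z0 m0 => a b _ m0; set rr := cmod _ in m0 *.
have rr2 : rr ^+ 2 = a ^+ 2 + b ^+ 2.
  by rewrite /rr /cmod /normc sqr_sqrtr // addr_ge0 ?sqr_ge0.
have rne : rr != 0 by rewrite gt_eqF.
have ar : -1 <= a / rr <= 1.
  rewrite ler_pdivlMr // ler_pdivrMr // mulN1r mul1r -ler_norml.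
  rewrite -(@ler_pXn2r _ 2) ?nnegrE ?(ltW m0) // real_normK ?num_real // rr2.
  by rewrite lerDl sqr_ge0.
have sa : rr * sin (acos (a / rr)) = `|b|.
  rewrite sin_acos // -{1}(ger0_norm (ltW m0)) -sqrtr_sqr -sqrtrM ?sqr_ge0 //.
  rewrite -sqrtr_sqr; congr Num.sqrt; rewrite mulrBr mulr1 expr_div_n mulrCA mulfV ?expf_neq0 //.
  by rewrite rr2; ring.
have ca : rr * cos (acos (a / rr)) = a by rewrite acosK ?in_itv //= mulrC divfK.
have [b0|b0] := leP 0 b.
  exists (acos (a / rr)); split; first exact: acos_ge0.
    by have := acos_lepi ar; have := @pi_ge0 R; lra.
  by rewrite /cis; simpc; rewrite ca sa ger0_norm.
exists (pi *+ 2 - acos (a / rr)); split.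
- by have := acos_lepi ar; have := @pi_ge0 R; lra.
- by have := acos_ge0 ar; lra.
rewrite /cis addrC sinD2pi cosD2pi cosN sinN; simpc.
by rewrite ca ?mulrN sa ltr0_norm // opprK.
Qed.

Lemma near_grid_point (x : R) (V : nat) : (0 < V)%N -> 0 <= x -> x <= 2 * pi ->
  exists2 l, (l < V)%N & `|x - 2 * pi * l%:R / V%:R| <= 2 * pi / V%:R.
Proof.
move=> V0 x0 x2; have p0 := @pi_gt0 R.
have V0' : (0 : R) < V%:R by rewrite ltr0n.
have Vne : (V%:R : R) != 0 by rewrite gt_eqF.
have p2ne : 2 * (pi : R) != 0 by rewrite gt_eqF ?mulr_gt0.
pose w := x * V%:R / (2 * pi).
have w0 : 0 <= w by rewrite /w divr_ge0 ?mulr_ge0 // ltW ?mulr_gt0.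
have wV : w <= V%:R by rewrite /w ler_pdivrMr ?mulr_gt0 // mulrC ler_wpM2l // ltW.
have xw : x = 2 * pi / V%:R * w.
  by rewrite /w; move: (2 * pi) p2ne => P Pne; field; rewrite Pne Vne.
suff [l lV lw] : exists2 l, (l < V)%N & `|w - l%:R| <= 1.
  exists l => //; have -> : x - 2 * pi * l%:R / V%:R = 2 * pi / V%:R * (w - l%:R).
    by rewrite {1}xw; ring.
  rewrite normrM ger0_norm ?ler_piMr //; first exact: divr_ge0 (mulr_ge0 _ (ltW p0)) (ltW V0').
  exact: divr_ge0 (mulr_ge0 _ (ltW p0)) (ltW V0').
have tl := @truncn_le _ w; rewrite w0 in tl; have tg := truncnS_gt w.
have [h|h] := ltnP (Num.trunc w) V.
  by exists (Num.trunc w) => //; rewrite ler_norml; rewrite -natr1 in tg; lra.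
(* Only x = 2 pi leads here: the integer part V is out of range, and V - 1 is at distance 1. *)
exists V.-1; first by rewrite prednK.
have : (V%:R : R) <= (Num.trunc w)%:R by rewrite ler_nat.
have : (V%:R : R) = V.-1%:R + 1 by rewrite natr1 prednK.
by rewrite ler_norml; lra.
Qed.

Lemma limn_le (u : nat -> R[i]^o) (Y : R) (M0 : nat) : 0 <= Y ->
  (forall M, (M0 <= M)%N -> cmod (u M) <= Y) -> cmod (limn u) <= Y.
Proof.
move=> Y0 H; have [cu|ncu] := pselect (cvgn u); last first.
  (* the limit of a divergent sequence is the default point 0 *)
  by rewrite (dvgP ncu) cmod0.
apply/ler_addgt0Pr => e e0.
have e0' : (0 : R[i]) < e%:C%C by rewrite ltcR.
have /cvgrPdist_lt/(_ _ e0')[M1 _ HM] : u @ \oo --> limn u := cu.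
have := HM (maxn M0 M1) (leq_maxr _ _); rewrite -cmodE ltcR => h.
rewrite -(subrK (u (maxn M0 M1)) (limn u)) addrC.
apply: (le_trans (cmodD _ _)); rewrite lerD // ?(ltW h) //.
exact: H (leq_maxl _ _).
Qed.

(** A term is a difference of consecutive partial sums, hence at most 2 once these are within 1 of
    the limit. *)
Lemma analytic_terms_bounded (b : nat -> R[i]) (r : R) : analytic_in_disc b ->
  0 <= r < 1 -> exists C, forall n, cmod (b n) * r ^+ n <= C.
Proof.
move=> ab /andP[r0 r1].
have cr : cmod r%:C%C = r by rewrite /cmod /normc /= expr0n addr0 sqrtr_sqr ger0_norm.
have := ab r%:C%C; rewrite cr => /(_ r1) cu.
have /cvgrPdist_lt/(_ _ ltr01)[M1 _ HM] :
  partial_sums b r%:C%C @ \oo --> limn (partial_sums b r%:C%C) := cu.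
set l := limn _ in HM; set u := partial_sums _ _ in HM.
exists (2 + \sum_(n < M1) cmod (b n) * r ^+ n) => n.
have T0 k : 0 <= cmod (b k) * r ^+ k by rewrite mulr_ge0 ?cmod_ge0 ?exprn_ge0.
have [nM|Mn] := ltnP n M1.
  rewrite (bigD1 (Ordinal nM)) //= addrCA lerDl addr_ge0 // sumr_ge0 //.
rewrite -[leLHS]addr0 lerD ?sumr_ge0 //.
have Et : cmod (b n) * r ^+ n = cmod (u n.+1 - u n).
  have -> : u n.+1 = u n + b n * r%:C%C ^+ n.
    by rewrite /u /partial_sums /series /= big_nat_recr.
  by rewrite addrAC subrr add0r cmodM cmodX cr.
rewrite Et (_ : u n.+1 - u n = (l - u n) - (l - u n.+1)); last first.
  by rewrite opprB [RHS]addrC addrA subrK.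
apply: (le_trans (cmodD _ _)); rewrite [X in _ + X]normcN.
have h1 : cmod (l - u n) < 1 by have := HM n Mn; rewrite -cmodE (ltcR _ 1).
have h2 : cmod (l - u n.+1) < 1.
  by have := HM n.+1 (leqW Mn); rewrite -cmodE (ltcR _ 1).
by rewrite /cmod in h1 h2 *; lra.
Qed.

(** Write e^x = r^2 with r = e^(x/2): one factor r^n tames the coefficient, the other leaves a
    geometric series. *)
Lemma analytic_majorant_bounded (b : nat -> R[i]) (x : R) : analytic_in_disc b ->
  x < 0 -> exists C, forall M, \sum_(n < M) (cmod (b n) + 1) * expR (n%:R * x) <= C.
Proof.
move=> ab x0; pose r := expR (x / 2).
have r0 : 0 <= r by exact: expR_ge0.
have r1 : r < 1 by rewrite expR_lt1 pmulr_llt0.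
have [|C HC] := @analytic_terms_bounded b r ab; first by rewrite r0.
have C0 : 0 <= C.
  by apply: le_trans (HC 0%N); rewrite mulr_ge0 ?cmod_ge0.
exists ((C + 1) / (1 - r)) => M.
rewrite ler_pdivlMr ?subr_gt0 //.
apply: (@le_trans _ _ ((\sum_(n < M) (C + 1) * r ^+ n) * (1 - r))).
  rewrite ler_wpM2r ?subr_ge0 ?(ltW r1) //; apply: ler_sum => n _.
  have -> : expR (n%:R * x) = r ^+ n * r ^+ n.
    by rewrite /r -!expRM_natl -expRD; congr expR; field.
  rewrite mulrA mulrDl mul1r ler_wpM2r ?exprn_ge0 // lerD ?HC //.
  by rewrite exprn_ile1 // ltW.
rewrite -mulr_sumr -mulrA ler_piMr ?addr_ge0 //.
have -> : (\sum_(n < M) r ^+ n) * (1 - r) = 1 - r ^+ M.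
  by rewrite mulrC -opprB -[RHS]opprB subrX1 mulNr.
by rewrite gerBl exprn_ge0.
Qed.

End ComplexLayer.

(** * Rotated polynomials on a circle *)

Section RotatedPolynomial.
Context {R : realType}.

Lemma sum_cis (N : nat) (rho be : nat -> R) :
  \sum_(n < N) (rho n)%:C%C * cis (be n) =
  ((\sum_(n < N) rho n * cos (be n)) +i* (\sum_(n < N) rho n * sin (be n)))%C.
Proof.
elim: N => [|N IH]; first by rewrite !big_ord0.
by rewrite !big_ord_recr /= IH /cis; simpc.
Qed.

Lemma sum_cos_close (N : nat) (rho u v : nat -> R) (mu : R) :
  (forall n, 0 <= rho n <= mu) ->
  `|\sum_(n < N) rho n * cos (u n)| <=
  `|\sum_(n < N) rho n * cos (v n)| + mu * \sum_(n < N) `|u n - v n|.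
Proof.
move=> Hrho.
have -> : \sum_(n < N) rho n * cos (u n) =
  \sum_(n < N) rho n * cos (v n) + \sum_(n < N) rho n * (cos (u n) - cos (v n)).
  by rewrite -big_split /=; apply: eq_bigr => n _; ring.
apply: (le_trans (ler_normD _ _)); rewrite lerD2l mulr_sumr.
apply: (le_trans (ler_norm_sum _ _ _)); apply: ler_sum => n _.
have /andP[h1 h2] := Hrho n.
by rewrite normrM (ger0_norm h1) ler_pM // cos_lipschitz.
Qed.

(** [random_phases] bounds real and imaginary parts at V arguments for t = t1; the Lipschitz bound
    for the cosine extends this to all arguments and to an interval of t, at the cost of 2 mu. *)
Lemma rotated_polynomial_bound (a : nat -> R[i]) (theta : nat -> nat)
    (N q m : nat) (r mu D tstar : R) :
  (0 < q)%N -> (0 < m)%N -> 0 <= r ->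
  (forall n, cmod (a n) * r ^+ n <= mu) ->
  0 < D -> \sum_(n < N) (cmod (a n) * r ^+ n) ^+ 2 <= D ^+ 2 ->
  (forall n, (n < theta n)%N) ->
  (forall i j, (i + q <= j < N)%N -> (2 * theta i <= theta j)%N) ->
  exists t1 tau, [/\ `|t1 - tstar| <= 2 * pi / m%:R, 0 < tau &
    forall t, `|t - t1| <= tau -> forall z, cmod z = r ->
      cmod (\sum_(n < N) rotate theta t a n * z ^+ n) <=
      2 * ((m + 2)%:R * mu +
       2 * (2 + ln (4 * q * m * (8 * N ^ 2 + 1))%:R) * (D * Num.sqrt (q * m)%:R))].
Proof.
move=> q0 m0 r0 Hmu D0 HD thn th2.
pose rho n := cmod (a n) * r ^+ n.
have rho0 n : 0 <= rho n by rewrite mulr_ge0 ?cmod_ge0 ?exprn_ge0.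
have mu0 : 0 <= mu := le_trans (rho0 0%N) (Hmu 0%N).
have [al Hal] : exists al : nat -> R, forall n, a n = (cmod (a n))%:C%C * cis (al n).
  have H n : exists x, a n = (cmod (a n))%:C%C * cis x.
    by have [x []] := polar (a n); exists x.
  by have [f Hf] := choice H; exists f.
(* As 2 pi < 8, passing to the nearest grid argument changes the N phases by at most 2 pi N^2 / V <=
   1 in total. *)
set V := (8 * N ^ 2 + 1)%N.
have V0 : (0 < V)%N by rewrite /V addn1.
have [t1 [Ht1 Hgrid]] := @random_phases R rho al theta N q m V mu D tstar q0 m0 V0
  rho0 (fun n _ => Hmu n) mu0 D0 HD thn th2.
set Y0 := m%:R * mu + _ in Hgrid.
pose S : R := (\sum_(n < N) theta n)%:R.
have S0 : 0 <= S by exact: ler0n.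
have S1 : 0 < S + 1 by lra.
(* With this radius the changes theta n (t - t1) also add up to at most 1. *)
exists t1, (S + 1)^-1; split => //; first by rewrite invr_gt0.
move=> t Ht z zr.
have [psi [psi0 psi2 Hz]] := polar z; rewrite zr in Hz.
have [l lV Hl] := near_grid_point psi V V0 psi0 psi2.
have Hj j : `|\sum_(n < N) rho n *
    cos (al n + (theta n)%:R * t + n%:R * psi + j%:R * (pi / 2))| <= 2 * mu + Y0.
  have Hrho n : 0 <= rho n <= mu by rewrite rho0 Hmu.
  have /le_trans := @sum_cos_close N rho
    (fun n => al n + (theta n)%:R * t + n%:R * psi + j%:R * (pi / 2))
    (fun n => al n + (theta n)%:R * t1 +
        n%:R * (2 * pi * l%:R / V%:R) + j%:R * (pi / 2)) mu Hrho; apply.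
  rewrite addrC lerD ?Hgrid // mulrC ler_wpM2r //.
  apply: (@le_trans _ _ (\sum_(n < N) ((theta n)%:R * (S + 1)^-1 + N%:R * (2 * pi / V%:R)))).
    apply: ler_sum => n _.
    have -> : al n + (theta n)%:R * t + n%:R * psi + j%:R * (pi / 2) -
       (al n + (theta n)%:R * t1 + n%:R * (2 * pi * l%:R / V%:R) + j%:R * (pi / 2)) =
       (theta n)%:R * (t - t1) + n%:R * (psi - 2 * pi * l%:R / V%:R) by ring.
    apply: (le_trans (ler_normD _ _)); rewrite !normrM !normr_nat lerD //.
      by rewrite ler_wpM2l.
    by rewrite ler_pM // ler_nat ltnW.
  rewrite big_split /= -mulr_suml -natr_sum -/S sumr_const card_ord.
  rewrite (_ : 2 = 1 + 1 :> R) // lerD //; first by rewrite ler_pdivrMr //; lra.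
  have V0' : (0 : R) < V%:R by rewrite ltr0n.
  rewrite -[leLHS]mulr_natr mulrAC mulrA ler_pdivrMr // mul1r.
  have pi4 : pi < 4 :> R by have := @pihalf_lt2 R; lra.
  rewrite /V natrD natrM natrX expr2.
  have : (0 : R) <= N%:R * N%:R by rewrite mulr_ge0.
  have p0 := @pi_gt0 R.
  move: (N%:R * N%:R : R) => X X0; nra.
have Ez n : rotate theta t a n * z ^+ n =
    (rho n)%:C%C * cis (al n + (theta n)%:R * t + n%:R * psi).
  rewrite /rotate Hz exprMn cisX {1}Hal !cisD /rho rmorphM rmorphXn /=; ring.
rewrite (eq_bigr (fun n : 'I_N => (rho n)%:C%C *
  cis (al n + (theta n)%:R * t + n%:R * psi))) //.
rewrite (sum_cis N rho (fun n => al n + (theta n)%:R * t + n%:R * psi)).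
have -> : 2 * ((m + 2)%:R * mu + 2 * (2 + ln (4 * q * m * V)%:R) *
   (D * Num.sqrt (q * m)%:R)) = 2 * (2 * mu + Y0) by rewrite /Y0 natrD; ring.
apply: cmod_le_ReIm => /=.
  have := Hj 0%N; congr (_ <= _); congr (`|_|).
  by apply: eq_bigr => n _; rewrite mul0r addr0.
have := Hj 1%N; congr (_ <= _); rewrite -normrN -sumrN; congr (`|_|).
by apply: eq_bigr => n _; rewrite mul1r cosDpihalf mulrN opprK.
Qed.

End RotatedPolynomial.

(** * Choice of the radius *)

Section Scale.
Context {R : realType}.

Lemma class_L_powR_bound (phi : R -> R) (delta eps : R) :
  0 < eps -> (gamma phi <= delta%:E)%E -> (forall n : nat, 0 < phi n%:R) ->
  exists N1 : nat, forall N, (N1 <= N)%N -> phi N%:R <= N%:R `^ (delta + eps).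
Proof.
move=> eps0 Hg phi0.
have : (gamma phi < (delta + eps)%:E)%E.
  by apply: (le_lt_trans Hg); rewrite lte_fin ltrDl.
rewrite /gamma limf_esupE => /ereal_inf_lt[_ [V [M0 [_ HV]] <-] Hsup].
(* The extra units place N beyond [M0] and keep [ln N] positive. *)
exists (Num.trunc `|M0|).+2 => N HN.
have N2 : (1 : R) < N%:R by rewrite ltr1n; lia.
have NM : M0 < N%:R.
  apply: (le_lt_trans (ler_norm _)); apply: (lt_le_trans (truncnS_gt _)).
  by rewrite ler_nat ltnW.
have lnN : 0 < ln N%:R :> R by rewrite ln_gt0.
have : ((ln (phi N%:R) / ln N%:R)%:E < (delta + eps)%:E)%E.
  by apply: le_lt_trans Hsup; apply: ereal_sup_ubound; exists N%:R => //; exact: HV.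
rewrite lte_fin ltr_pdivrMr // -ln_powR ltr_ln ?posrE ?powR_gt0 //; first exact: ltW.
by lra.
Qed.

(** * Doubling of the frequencies *)

Section Lacunary.
Variables (phi : R -> R) (theta : nat -> nat).
Hypothesis phiL : class_L phi.
Hypothesis phi0 : forall n : nat, 0 < phi n%:R.
Hypothesis theta_gt0 : forall n, (0 < theta n)%N.
Hypothesis ratio : forall n : nat,
  (theta n.+1)%:R / (theta n)%:R >= 1 + 1 / phi n%:R.

Lemma theta_step n : (theta n)%:R + (theta n)%:R / phi n%:R <= (theta n.+1)%:R :> R.
Proof.
have t0 : (0 : R) < (theta n)%:R by rewrite ltr0n.
by have := ratio n; rewrite ler_pdivlMr // mulrDl !mul1r mulrC.
Qed.

Lemma theta_increasing n : (theta n < theta n.+1)%N.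
Proof.
rewrite -(ltr_nat R); apply: lt_le_trans (theta_step n).
by rewrite ltrDl divr_gt0 // ltr0n.
Qed.

Lemma theta_gt_id n : (n < theta n)%N.
Proof.
elim: n => [|n IH]; first exact: theta_gt0.
exact: leq_ltn_trans IH (theta_increasing n).
Qed.

Lemma theta_mono : {homo theta : i j / (i <= j)%N}.
Proof. by apply: homo_leq => // [|n]; [exact: leq_trans|exact: ltnW (theta_increasing n)]. Qed.

(** By monotonicity of theta and phi, each step from i on adds at least theta i / phi N, and there
    are at least q >= phi N steps. *)
Lemma theta_doubling (N q : nat) : phi N%:R <= q%:R ->
  forall i j, (i + q <= j < N)%N -> (2 * theta i <= theta j)%N.
Proof.
move=> phiq i j /andP[iqj jN].
have H k : (i + k <= N)%N ->
    (theta i)%:R * (1 + k%:R / phi N%:R) <= (theta (i + k))%:R :> R.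
  elim: k => [|k IH] kN; first by rewrite addn0 mul0r addr0 mulr1.
  rewrite addnS; apply: le_trans (theta_step (i + k)).
  have h1 := IH ltac:(lia).
  have h2 : (theta i)%:R <= (theta (i + k))%:R :> R.
    by rewrite ler_nat theta_mono // leq_addr.
  have h3 : (phi N%:R)^-1 <= (phi (i + k)%:R)^-1.
    rewrite lef_pV2 ?posrE ?phi0 //; case: phiL => _ + _; apply => //.
    by rewrite ler_nat; lia.
  have h4 : (theta i)%:R / phi N%:R <= (theta (i + k))%:R / phi (i + k)%:R.
    by rewrite ler_pM // invr_ge0 ltW.
  rewrite -[k.+1%:R]natr1; lra.
have := H (j - i)%N; rewrite subnKC; last by lia.
move=> /(_ ltac:(lia)) h.
rewrite -(ler_nat R) natrM mulrC; apply: le_trans h.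
rewrite ler_wpM2l // (_ : 2 = 1 + 1 :> R) // lerD2l ler_pdivlMr ?phi0 // mul1r.
by apply: (le_trans phiq); rewrite ler_nat; lia.
Qed.

End Lacunary.

Lemma max_term_ge (b : nat -> R[i]) (r : R) (n : nat) : analytic_in_disc b ->
  0 <= r < 1 -> cmod (b n) * r ^+ n <= max_term b r.
Proof.
move=> ab rr; apply: ub_le_sup; last by exists n.
have [C HC] := analytic_terms_bounded b r ab rr.
by exists C => _ [k _ <-].
Qed.

Lemma inv_le_h_disc (y : R) : y < 0 -> (- y)^-1 <= h_disc (expR y).
Proof.
move=> y0; rewrite /h_disc lef_pV2 ?posrE ?oppr_gt0 ?subr_gt0 ?expR_lt1 //.
by have := expR_ge1Dx y; lra.
Qed.

Lemma ln_le_quarter (x : R) : 64 <= x -> ln x <= x / 4.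
Proof.
move=> x64; have x0 : 0 < x by lra.
pose s := Num.sqrt x.
have ss : s ^+ 2 = x by rewrite sqr_sqrtr // ltW.
have s0 : 0 < s by rewrite sqrtr_gt0.
have s8 : 8 <= s.
  rewrite -(@ler_pXn2r _ 2) ?nnegrE ?sqrtr_ge0 // ss; apply: le_trans x64.
  by rewrite -natrX.
rewrite -ss lnXn //; have := ln_sublinear s0; nra.
Qed.

(** Turns the quantities of [wiman_valiron] into powers of B = h^2 L: s >= 1/2 gives h <= (h^2)^s,
    and gam <= 2 L does the rest. *)
Lemma scale_le (h L gam s : R) : 1 <= h -> 0 < L -> 0 < gam -> gam <= 2 * L ->
  2^-1 <= s -> gam `^ s * h <= 2 `^ s * (h ^+ 2 * L) `^ s.
Proof.
move=> h1 L0 g0 gL s2.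
have h0 : 0 < h by lra.
have -> : 2 `^ s * (h ^+ 2 * L) `^ s = (2 * L) `^ s * (h ^+ 2) `^ s.
  rewrite (powRM s (exprn_ge0 2 (ltW h0)) (ltW L0)) (powRM s (ler0n _ 2) (ltW L0)).
  by rewrite mulrCA mulrC.
rewrite ler_pM ?powR_ge0 ?(ltW h0) //.
  by apply: ge0_ler_powR; rewrite ?nnegrE; lra.
rewrite -powR_mulrn ?(ltW h0) // -powRrM.
by apply: le1r_powR => //; lra.
Qed.

(** [wiman_valiron] applied to the coefficients |a_n| + 1; the added 1 costs only a constant factor,
    as mu is bounded below by [c0] once r >= 1/2. *)
Lemma good_scale (a : nat -> R[i]) (r0 eps : R) :
  analytic_in_disc a -> (exists n0, a n0 != 0) -> r0 < 1 -> 0 < eps <= 2^-1 ->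
  exists2 c : R, 0 < c & forall B0 : R, exists r (N : nat),
    let mu := max_term a r in let h := h_disc r in let L := ln (h * mu) in
    let B := h ^+ 2 * L in
    [/\ r0 < r, 0 < r < 1, B0 <= B, 0 < h & 0 < L] /\
    [/\ 1 <= c * mu,
       forall M, \sum_(n < M) cmod (a n) * r ^+ n <= c * mu * B `^ (2^-1 + eps),
       N%:R <= B `^ (1 + 2 * eps), B0 <= N%:R &
       forall M, \sum_(n < M | (N <= n)%N) cmod (a n) * r ^+ n <= 1].
Proof.
move=> aa [n0 an0] r01 /andP[eps0 eps2].
have c00 : 0 < cmod (a n0) * 2^-1 ^+ n0.
  rewrite mulr_gt0 ?exprn_gt0 // lt_neqAle cmod_ge0 andbT eq_sym.
  by apply: contra an0 => /eqP /ComplexField.Normc.eq0_normc ->.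
set c0 := cmod (a n0) * _ in c00.
pose c1 := 1 + c0^-1.
have c11 : 1 < c1 by rewrite ltrDl invr_gt0.
exists (168 * c1); first by rewrite mulr_gt0 //; clear -c11; lra.
move=> B0.
pose A n := cmod (a n) + 1.
have A1 n : 1 <= A n by rewrite lerDr cmod_ge0.
have Abnd x : x < 0 -> exists C, forall M, \sum_(n < M) A n * expR (n%:R * x) <= C.
  exact: analytic_majorant_bounded.
pose rho := Num.max r0 2^-1.
have rho0 : 0 < rho by rewrite lt_max invr_gt0 ltr0n orbT.
have rho1 : rho < 1 by rewrite gt_max r01 invf_lt1 // ltr1n.
(* Half of ln rho forces r > rho strictly; the bound -1 gives 1 / (- y) >= 1 and hence h >= 1. *)
pose x0 := Num.max (ln rho / 2) (-1).
have x00 : x0 < 0 by rewrite gt_max ltrN10 andbT pmulr_llt0 // ln_lt0 // rho0.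
have ln17 : 0 <= 17 `^ eps^-1 :> R by exact: powR_ge0.
(* In turn: 64 for [ln_le_quarter], the logarithm to absorb the constant in [gL], 2 |B0| for B0 <=
   B, and the last for 17 <= B^eps, which turns N <= w + 1 <= 17 B^(1 + eps) into a pure power of
   B. *)
pose Gam := Num.max (Num.max 64 (4 * ln (84 * c1)))
              (Num.max (2 * `|B0|) (2 * 17 `^ eps^-1)).
have [y [gam [/andP[x0y y0] + ggy Hmax Htail]]] := wiman_valiron A A1 Abnd eps x0 Gam eps0 x00.
rewrite !ge_max => /andP[/andP[g64 gc1] /andP[gB0 g17]].
have g0 : 0 < gam by lra.
pose r := expR y.
have rr : 0 < r < 1 by rewrite expR_gt0 expR_lt1.
have rr' : 0 <= r < 1 by rewrite expR_ge0 expR_lt1.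
have rhor : rho < r.
  rewrite -[ltLHS]lnK ?posrE // ltr_expR; apply: lt_le_trans x0y.
  have := ln_lt0 (introT andP (conj rho0 rho1)).
  by rewrite lt_max => h; apply/orP; left; lra.
have r12 : 2^-1 <= r by apply: le_trans (ltW rhor); rewrite le_max lexx orbT.
pose mu := max_term a r.
have muE n : cmod (a n) * r ^+ n <= mu by exact: max_term_ge.
have c0mu : c0 <= mu.
  apply: le_trans (muE n0); rewrite ler_wpM2l ?cmod_ge0 //.
  by rewrite lerXn2r ?nnegrE ?invr_ge0 ?expR_ge0.
have mu0 : 0 < mu by apply: lt_le_trans c0mu.
have onemu : 1 <= c0^-1 * mu by rewrite mulrC ler_pdivlMr // mul1r.
have Amu n : A n * expR (n%:R * y) <= c1 * mu.
  rewrite expRM_natl -/r mulrDl /c1 mulrDl !mul1r lerD //.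
  apply: le_trans onemu; rewrite exprn_ile1 ?expR_ge0 //; by case/andP: rr => _ /ltW.
pose h := h_disc r.
have hy : (- y)^-1 <= h by exact: inv_le_h_disc.
have ny1 : 1 <= (- y)^-1.
  rewrite invf_ge1 ?oppr_gt0 //; have : -1 <= x0 by rewrite le_max lexx orbT.
  by clear -x0y; lra.
have h1 : 1 <= h by exact: le_trans hy.
have h0 : 0 < h := lt_le_trans ltr01 h1.
pose L := ln (h * mu).
have hmu0 : 0 < h * mu by rewrite mulr_gt0.
have G0 := psup_gt0 A A1 Abnd y0.
have Gle : psup A y <= 84 * c1 * (h * mu) * gam `^ (2^-1 + eps).
  apply: (le_trans (Hmax _ Amu)).
  have -> : 84 * (c1 * mu) * (gam `^ (2^-1 + eps) / - y) =
    (84 * c1 * mu * gam `^ (2^-1 + eps)) * (- y)^-1 by ring.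
  have -> : 84 * c1 * (h * mu) * gam `^ (2^-1 + eps) =
    (84 * c1 * mu * gam `^ (2^-1 + eps)) * h by ring.
  by rewrite ler_wpM2l // !mulr_ge0 ?powR_ge0 ?(ltW mu0) //; clear -c11; lra.
(* In the upper bound for ln (psup A y), which is at least gam, the constant and the power of gam
   cost at most gam / 4 each. *)
have gL : gam <= 2 * L.
  have lng : ln gam <= gam / 4 by exact: ln_le_quarter.
  have lng0 : 0 <= ln gam by rewrite ln_ge0 //; clear -g64; lra.
  have : ln (psup A y) <= ln (84 * c1) + L + (2^-1 + eps) * ln gam.
    have c84 : 0 < 84 * c1 by clear -c11; lra.
    have pg : 0 < gam `^ (2^-1 + eps) by exact: powR_gt0.
    have ch : 0 < 84 * c1 * (h * mu) by exact: mulr_gt0.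
    rewrite -ln_powR /L -lnM ?posrE // -lnM ?posrE //.
    by rewrite ler_ln ?posrE //; exact: mulr_gt0.
  have : (2^-1 + eps) * ln gam <= 1 * ln gam by rewrite ler_wpM2r //; clear -eps2; lra.
  by clear -ggy gc1 lng; lra.
have L0 : 0 < L by clear -gL g64; lra.
pose B := h ^+ 2 * L.
have LB : L <= B by rewrite /B ler_peMl ?(ltW L0) // exprn_ege1.
have B0' : 0 < B by exact: lt_le_trans LB.
have B1 : 1 <= B by clear -LB gL g64; lra.
pose w := 4 * gam `^ (1 + eps) / - y.
have w0 : 0 <= w.
  by rewrite /w mulr_ge0 ?mulr_ge0 ?powR_ge0 // (le_trans ler01).
pose N := (Num.trunc w).+1.
have wN : w <= N%:R by exact: ltW (truncnS_gt _).
have Rr n : 0 <= r ^+ n by rewrite exprn_ge0 ?expR_ge0.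
have pw0 (s : R) : 0 <= B `^ s by exact: powR_ge0.
exists r, N; split; first split => //.
- by apply: le_lt_trans rhor; rewrite le_max lexx.
- by apply: le_trans LB; have := ler_norm B0; clear -gB0 gL; lra.
split.
- apply: (le_trans onemu); rewrite ler_wpM2r ?(ltW mu0) // /c1.
  by have : 0 <= c0^-1 by [rewrite invr_ge0 ltW]; clear; lra.
- move=> M; apply: (@le_trans _ _ (psup A y)).
    apply: (le_trans _ (psum_le_psup A Abnd M y0)); apply: ler_sum => n _.
    by rewrite expRM_natl -/r ler_wpM2r // lerDl.
  apply: (le_trans Gle); rewrite -/mu -/h -/L -/B.
  have h12 : 2^-1 <= 2^-1 + eps by clear -eps0; lra.
  have := scale_le _ _ _ _ h1 L0 g0 gL h12; rewrite -/B => sc.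
  have p2 : 2 `^ (2^-1 + eps) <= 2 :> R by apply: ler1_powR; [rewrite ler1n|clear -eps2; lra].
  have -> : 84 * c1 * (h * mu) * gam `^ (2^-1 + eps) =
     84 * c1 * mu * (gam `^ (2^-1 + eps) * h) by ring.
  have -> : 168 * c1 * mu * B `^ (2^-1 + eps) = 84 * c1 * mu * (2 * B `^ (2^-1 + eps)) by ring.
  rewrite ler_wpM2l ?mulr_ge0 ?(ltW mu0) //; first by clear -c11; lra.
  by apply: (le_trans sc); rewrite ler_wpM2r.
- rewrite -/mu -/h -/L -/B.
  have h12 : 2^-1 <= 1 + eps by clear -eps0; lra.
  have := scale_le _ _ _ _ h1 L0 g0 gL h12; rewrite -/B => sc.
  have p4 : 2 `^ (1 + eps) <= 4 :> R.
    rewrite powRD ?pnatr_eq0 ?implybT // powRr1 // (_ : 4 = 2 * 2 :> R); last by rewrite -natrM.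
    by rewrite ler_wpM2l // ler1_powR ?ler1n //; clear -eps2; lra.
  have Nw : N%:R <= w + 1.
    by rewrite /N -natr1 lerD2r; have := @truncn_le _ w; rewrite w0.
  have ww : w <= 16 * B `^ (1 + eps).
    apply: (@le_trans _ _ (4 * (gam `^ (1 + eps) * h))).
      by rewrite /w -mulrA ler_wpM2l // ler_wpM2l ?powR_ge0.
    have := ler_wpM2r (pw0 (1 + eps)) p4; clear -sc; lra.
  have Bp1 : 1 <= B `^ (1 + eps).
    by rewrite -[leLHS](powRr0 B) ler_powR //; clear -eps0; lra.
  have B17 : 17 <= B `^ eps.
    have e17 : (17 `^ eps^-1) `^ eps = 17 :> R.
      by rewrite -powRrM mulVf ?gt_eqF // powRr1.
    rewrite -{1}e17; apply: ge0_ler_powR; rewrite ?nnegrE //; [exact: ltW|exact: ltW|].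
    by apply: le_trans LB; clear -g17 gL; lra.
  have -> : 1 + 2 * eps = eps + (1 + eps) by ring.
  rewrite powRD; last by rewrite (gt_eqF B0') implybT.
  have := ler_wpM2r (pw0 (1 + eps)) B17; clear -Nw ww Bp1; lra.
- apply: le_trans wN; apply: (@le_trans _ _ gam); first by have := ler_norm B0; clear -gB0 g64; lra.
  apply: (@le_trans _ _ (gam `^ (1 + eps) * 1)).
    by rewrite mulr1; apply: le1r_powR; clear -g64 eps0; lra.
  have gp : 0 <= gam `^ (1 + eps) by exact: powR_ge0.
  by rewrite /w ler_pM //; clear -gp; lra.
- move=> M; apply: le_trans (Htail N M wN); apply: ler_sum => n _.
  by rewrite expRM_natl -/r ler_wpM2r // lerDl.
Qed.

End Scale.

(** * From bounds on the modulus to bounds on [Delta] *)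

Section DeltaBound.
Context {R : realType}.

Lemma max_term_rotate (theta : nat -> nat) (t : R) (a : nat -> R[i]) (r : R) :
  max_term (rotate theta t a) r = max_term a r.
Proof.
rewrite /max_term; congr sup; apply: eq_imagel => n _.
by rewrite /rotate cmodM cmod_cis mulr1.
Qed.

Lemma max_modulus_le (b : nat -> R[i]) (r Y : R) : 0 <= r ->
  (forall z, cmod z = r -> cmod (power_sum b z) <= Y) -> max_modulus b r <= Y.
Proof.
move=> r0 H; apply: ge_sup; last by move=> _ [z zr <-]; exact: H.
exists (cmod (power_sum b r%:C%C)), r%:C%C => //=.
by rewrite /cmod /ComplexField.Normc.normc /= expr0n addr0 sqrtr_sqr ger0_norm.
Qed.

Lemma power_sum_rotate_le (theta : nat -> nat) (t : R) (a : nat -> R[i]) (z : R[i])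
    (N : nat) (X : R) : 0 <= X ->
  cmod (\sum_(n < N) rotate theta t a n * z ^+ n) <= X ->
  (forall M, \sum_(n < M | (N <= n)%N) cmod (a n) * cmod z ^+ n <= 1) ->
  cmod (power_sum (rotate theta t a) z) <= X + 1.
Proof.
move=> X0 HX Htail; apply: (limn_le _ _ N); first by rewrite addr_ge0.
move=> M NM; rewrite /partial_sums /series /= big_mkord.
rewrite (bigID (fun n : 'I_M => (n < N)%N)) /=.
rewrite -(big_ord_widen _ (fun n => rotate theta t a n * z ^+ n) NM).
apply: (le_trans (cmodD _ _)); rewrite lerD //.
apply: (le_trans (cmod_sum _ _ _ _)); apply: le_trans (Htail M).
rewrite le_eqVlt; apply/orP; left; apply/eqP; apply: eq_big => [n|n _].
  by rewrite -leqNgt.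
by rewrite cmodM cmodX /rotate cmodM cmod_cis mulr1.
Qed.

(** The denominator of [Delta] is ln B, so the exponent of B bounds the quotient. *)
Lemma Delta_le (b : nat -> R[i]) (r E : R) :
  let mu := max_term b r in let h := h_disc r in let L := ln (h * mu) in
  let B := h ^+ 2 * L in
  0 < h -> 0 < L -> 1 < B -> 0 < mu -> 1 <= mu * B `^ E ->
  max_modulus b r <= mu * B `^ E -> Delta h_disc b r <= E.
Proof.
move=> mu h L B h0 L0 B1 mu0 Y1 HM.
have lnB : 2 * ln h + ln L = ln B.
  by rewrite /B lnM ?posrE ?exprn_gt0 // lnXn // -[ln h *+ 2]mulr_natl.
have B0 : 0 < B by exact: lt_trans B1.
rewrite /Delta -/mu -/h -/L lnB ler_pdivrMr ?ln_gt0 // lerBlDl.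
have -> : ln mu + E * ln B = ln (mu * B `^ E).
  by rewrite lnM ?posrE ?powR_gt0 // ln_powR.
have [M0|M0] := leP (max_modulus b r) 0.
  (* ln is 0 on nonpositive arguments *)
  by apply: (@le_trans _ _ 0); [rewrite ln_le0 // (le_trans M0)|exact: ln_ge0].
by rewrite ler_ln ?posrE // (lt_le_trans M0).
Qed.

Lemma ln_le_powR (B eps : R) : 0 < B -> 0 < eps -> ln B <= eps^-1 * B `^ eps.
Proof.
move=> B0 eps0; have := ln_sublinear (powR_gt0 eps B0); rewrite ln_powR => h.
by rewrite mulrC ler_pdivlMr // mulrC ltW.
Qed.

(** Exponent count: q <= 2 N^s <= 2 B^(e1 s), so the product under the root has exponent at most p +
    e1 s. *)
Lemma sqrt_blocks_le (c B p s e1 x : R) (m q N : nat) :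
  0 <= c -> 1 <= B -> 0 <= s -> q%:R <= 2 * N%:R `^ s -> N%:R <= B `^ e1 ->
  p + e1 * s <= 2 * x ->
  Num.sqrt (c * B `^ p) * Num.sqrt (q * m)%:R <=
  Num.sqrt (2 * c * m%:R) * B `^ x.
Proof.
move=> c0 B1 s0 qN NB ex; have B0 : 0 < B by lra.
have -> : B `^ x = Num.sqrt (B `^ (2 * x)).
  have -> : B `^ (2 * x) = B `^ x ^+ 2.
    by rewrite mulrC powRrM powR_mulrn ?powR_ge0.
  by rewrite sqrtr_sqr ger0_norm ?powR_ge0.
rewrite -!sqrtrM ?mulr_ge0 ?powR_ge0 //; apply: ler_wsqrtr.
have qB : q%:R <= 2 * B `^ (e1 * s).
  apply: (le_trans qN); rewrite ler_wpM2l // powRrM.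
  by apply: ge0_ler_powR; rewrite ?nnegrE ?powR_ge0.
rewrite natrM.
have -> : c * B `^ p * (q%:R * m%:R) = c * m%:R * (B `^ p * q%:R) by ring.
have -> : 2 * c * m%:R * B `^ (2 * x) = c * m%:R * (2 * B `^ (2 * x)) by ring.
rewrite ler_wpM2l ?mulr_ge0 //.
apply: (@le_trans _ _ (B `^ p * (2 * B `^ (e1 * s)))).
  by rewrite ler_wpM2l ?powR_ge0.
rewrite mulrCA ler_wpM2l // -powRD ?(gt_eqF B0) ?implybT //.
by rewrite ler_powR.
Qed.

(** The count is at most 72 m N^3 with N <= B^2, so its logarithm is linear in ln B, hence
    O(B^eps). *)
Lemma ln_sample_count_le (B eps : R) (m q N : nat) : 1 <= B -> 0 < eps <= 2^-1 ->
  (0 < m)%N -> (0 < N)%N -> (0 < q)%N -> (q <= 2 * N)%N ->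
  N%:R <= B `^ (1 + 2 * eps) ->
  2 + ln (4 * q * m * (8 * N ^ 2 + 1))%:R <=
  (2 + ln (72 * m)%:R + 6 / eps) * B `^ eps.
Proof.
move=> B1 /andP[eps0 eps2] m0 N0 q0 qN NB; have B0 : 0 < B by lra.
have N0' : (0 : R) < N%:R by rewrite ltr0n.
have m0' : (0 : R) < (72 * m)%:R by rewrite ltr0n muln_gt0.
have c1 : (4 * q * m * (8 * N ^ 2 + 1) <= 72 * m * N ^ 3)%N.
  have : (8 * N ^ 2 + 1 <= 9 * N ^ 2)%N by nia.
  move=> h; apply: (@leq_trans (4 * (2 * N) * m * (9 * N ^ 2))); last by lia.
  by rewrite leq_mul // leq_mul // leq_mul.
have h1 : ln (4 * q * m * (8 * N ^ 2 + 1))%:R <= ln (72 * m)%:R + 3 * ln N%:R :> R.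
  have -> : ln (72 * m)%:R + 3 * ln N%:R = ln (72 * m * N ^ 3)%:R :> R.
    rewrite [in RHS]natrM natrX lnM ?posrE ?exprn_gt0 // lnXn //.
    by rewrite -[ln N%:R *+ 3]mulr_natl.
  rewrite ler_ln ?posrE ?ltr0n ?ler_nat //.
    by rewrite !muln_gt0 q0 m0 addn1.
  by rewrite !muln_gt0 m0 ?expn_gt0 ?N0.
have lnB0 : 0 <= ln B by exact: ln_ge0.
have h2 : ln N%:R <= 2 * ln B.
  have : ln N%:R <= (1 + 2 * eps) * ln B.
    by rewrite -ln_powR ler_ln ?posrE ?powR_gt0.
  have : (1 + 2 * eps) * ln B <= 2 * ln B by rewrite ler_wpM2r //; lra.
  lra.
have h3 := ln_le_powR _ _ B0 eps0.
have Be1 : 1 <= B `^ eps by rewrite -[leLHS](powRr0 B) ler_powR // ltW.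
have l72 : 0 <= ln (72 * m)%:R :> R.
  by rewrite ln_ge0 // ler1n muln_gt0.
have : (2 + ln (72 * m)%:R) * 1 <= (2 + ln (72 * m)%:R) * B `^ eps.
  by rewrite ler_wpM2l //; lra.
by rewrite [_ * B `^ eps]mulrDl; lra.
Qed.

(** All three expressions equal 1/2 at delta = 1/2; cleared of denominators, the second claim reads
    delta^2 <= delta / 2. *)
Lemma exponent_le (delta : R) : 0 <= delta ->
  (2^-1 <= delta -> 2^-1 <= (1 + 3 * delta) / (4 + 2 * delta)) /\
  (delta <= 2^-1 -> 4^-1 + delta / 2 <= (1 + 3 * delta) / (4 + 2 * delta)).
Proof.
move=> d0; have d4 : 0 < 4 + 2 * delta by lra.
by split => d2; rewrite ler_pdivlMr //; nra.
Qed.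

(** One radius r serves a whole interval of t, which is what nowhere density requires. *)
Lemma rotations_Delta_le (delta : R) (theta : nat -> nat) (phi : R -> R)
    (a : nat -> R[i]) (r0 e tstar eta : R) :
  0 <= delta -> (forall n, (0 < theta n)%N) ->
  class_L phi -> (gamma phi <= delta%:E)%E -> (forall n : nat, 0 < phi n%:R) ->
  (forall n : nat, (theta n.+1)%:R / (theta n)%:R >= 1 + 1 / phi n%:R) ->
  analytic_in_disc a -> (exists n0, a n0 != 0) -> r0 < 1 -> 0 < e -> 0 < eta ->
  exists r t1 tau, [/\ r0 < r < 1, `|t1 - tstar| < eta, 0 < tau &
    forall t, `|t - t1| <= tau ->
      Delta h_disc (rotate theta t a) r <= (1 + 3 * delta) / (4 + 2 * delta) + e].
Proof.
move=> d0 theta0 phiL gphi phi0 ratio aa an0 r01 e0 eta0.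
set C := _ / _; have [C1 C2] := exponent_le _ d0; rewrite -/C in C1 C2.
(* The exponent loses 2 eps in [sqrt_blocks_le], eps in the logarithm and eps in absorbing the
   constant. *)
pose eps := Num.min 2^-1 (e / 4).
have eps0 : 0 < eps by rewrite lt_min invr_gt0 divr_gt0 // ltr0n.
have eps2 : eps <= 2^-1 by rewrite ge_min lexx.
have epse : 4 * eps <= e.
  have : eps <= e / 4 by rewrite ge_min lexx orbT.
  lra.
have epsP : 0 < eps <= 2^-1 by rewrite eps0.
have [c c0 Hscale] := good_scale a r0 eps aa an0 r01 epsP.
have [N1 HN1] := class_L_powR_bound phi delta eps eps0 gphi phi0.
pose m := (Num.trunc (8 / eta)).+1.
have meta : 2 * pi / m%:R < eta.
  rewrite ltr_pdivrMr ?ltr0n //.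
  have := truncnS_gt (8 / eta); rewrite -/m ltr_pdivrMr // mulrC => h.
  by have := @pihalf_lt2 R; lra.
pose K1 : R := 2 + ln (72 * m)%:R + 6 / eps.
(* The constant collected at the end; B is taken so large that K2 <= B^eps. *)
pose K2 := c + 2 * (m + 2)%:R + 4 * (K1 * Num.sqrt (2 * c * m%:R)).
have K10 : 0 <= K1.
  by rewrite !addr_ge0 ?ln_ge0 ?ler1n ?muln_gt0 // divr_ge0 // ltW.
have K3 : 0 <= K1 * Num.sqrt (2 * c * m%:R) by rewrite mulr_ge0 ?sqrtr_ge0.
have cK2 : c <= K2 by rewrite /K2 -addrA lerDl addr_ge0 ?mulr_ge0.
have K20 : 0 <= K2 by apply: le_trans cK2; exact: ltW.
have [r [N []]] := Hscale (Num.max (Num.max 2 (K2 `^ eps^-1)) N1%:R).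
set mu := max_term a r; set h := h_disc r; set L := ln (h * mu).
set B := h ^+ 2 * L; rewrite !ge_max.
move=> [r0r /andP[rpos r1] /andP[/andP[B2 BK] _] h0 L0].
move=> [cmu Hsum NB /andP[/andP[N2 _] NN1] Htail].
have B1 : 1 < B by clear -B2; lra.
have B0 : 0 < B := lt_trans ltr01 B1.
have mu0 : 0 < mu by rewrite -(pmulr_rgt0 _ c0) (lt_le_trans ltr01).
have KB : K2 <= B `^ eps.
  have {1}-> : K2 = (K2 `^ eps^-1) `^ eps.
    by rewrite -powRrM mulVf ?gt_eqF // powRr1.
  by apply: ge0_ler_powR; rewrite ?nnegrE ?powR_ge0 // ltW.
have absorb x k : 0 <= k -> k <= K2 -> x + eps <= C + e ->
    k * mu * B `^ x <= mu * B `^ (C + e).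
  move=> k0 kK xE; rewrite (mulrC k) -mulrA ler_wpM2l ?(ltW mu0) //.
  apply: (@le_trans _ _ (B `^ eps * B `^ x)).
    by rewrite ler_wpM2r ?powR_ge0 // (le_trans kK).
  by rewrite -powRD ?(gt_eqF B0) ?implybT // ler_powR ?(ltW B1) //; clear -xE; lra.
have C0 : 0 <= C by rewrite /C divr_ge0 //; clear -d0; lra.
have Y1 : 1 <= mu * B `^ (C + e).
  apply: (le_trans cmu); have := absorb 0 c (ltW c0) cK2.
  by rewrite powRr0 mulr1; apply; clear -C0 epse eps0; lra.
have muE n : cmod (a n) * r ^+ n <= mu.
  by apply: max_term_ge => //; rewrite (ltW rpos).
suff [t1 [tau [Ht1 tau0 Hmod]]] : exists t1 tau, [/\ `|t1 - tstar| < eta, 0 < tau &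
    forall t, `|t - t1| <= tau -> forall z, cmod z = r ->
      cmod (power_sum (rotate theta t a) z) <= mu * B `^ (C + e)].
  exists r, t1, tau; split => //; first by rewrite r0r.
  move=> t Ht; apply: Delta_le; rewrite ?max_term_rotate //.
  by apply: max_modulus_le; [exact: ltW|exact: Hmod].
(* For delta >= 1/2 the sum of absolute values already has exponent 1/2 + eps with 1/2 <= C, for
   every t. *)
have [d2|d2] := leP 2^-1 delta.
  exists tstar, 1; split; rewrite ?subrr ?normr0 // => t _ z zr.
  apply: (@le_trans _ _ (c * mu * B `^ (2^-1 + eps))); last first.
    by apply: absorb; rewrite ?(ltW c0) //; have := C1 d2; clear -epse eps0; lra.
  apply: (limn_le _ _ 0%N); first by rewrite !mulr_ge0 ?powR_ge0 // ltW.
  move=> M _; rewrite /partial_sums /series /= big_mkord.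
  apply: (le_trans (cmod_sum _ _ _ _)); apply: le_trans (Hsum M).
  rewrite le_eqVlt; apply/orP; left; apply/eqP; apply: eq_bigr => n _.
  by rewrite cmodM cmodX /rotate cmodM cmod_cis mulr1 zr.
have N0 : (0 < N)%N by rewrite -(ltr0n R); clear -N2; lra.
have N1' : (1 : R) <= N%:R by rewrite ler1n.
pose s := delta + eps.
have s0 : 0 <= s by rewrite /s; clear -d0 eps0; lra.
have s1 : s <= 1 by rewrite /s; clear -d2 eps2; lra.
(* This q lies between N^s and 2 N^s, so it exceeds phi N and stays below 2 N up to equality. *)
pose q := (Num.trunc (N%:R `^ s : R)).+1.
have Ns1 : 1 <= N%:R `^ s :> R by rewrite -[leLHS](powRr0 N%:R) ler_powR.
have qN : q%:R <= 2 * N%:R `^ s :> R.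
  have := @truncn_le _ (N%:R `^ s : R); rewrite powR_ge0 /q -natr1; clear -Ns1; lra.
have q2N : (q <= 2 * N)%N.
  rewrite -(ler_nat R) natrM; apply: (le_trans qN); rewrite ler_wpM2l //.
  by rewrite ler1_powR.
have phiq : phi N%:R <= q%:R.
  apply: (le_trans (HN1 N _)); first by rewrite -(ler_nat R).
  exact: ltW (truncnS_gt _).
(* The sum of squares is at most mu times the sum, which [Hsum] bounds. *)
pose D := mu * Num.sqrt (c * B `^ (2^-1 + eps)).
have D0 : 0 < D by rewrite mulr_gt0 // sqrtr_gt0 mulr_gt0 ?powR_gt0.
have HD : \sum_(n < N) (cmod (a n) * r ^+ n) ^+ 2 <= D ^+ 2.
  rewrite /D exprMn sqr_sqrtr ?mulr_ge0 ?powR_ge0 ?(ltW c0) //.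
  apply: (@le_trans _ _ (\sum_(n < N) mu * (cmod (a n) * r ^+ n))).
    apply: ler_sum => n _; rewrite expr2 ler_wpM2r //.
    by rewrite mulr_ge0 ?cmod_ge0 ?exprn_ge0 // ltW.
  rewrite -mulr_sumr (_ : mu ^+ 2 * _ = mu * (c * mu * B `^ (2^-1 + eps))); last by ring.
  by rewrite ler_wpM2l ?(ltW mu0).
have thn := theta_gt_id phi theta phi0 theta0 ratio.
have th2 := theta_doubling phi theta phiL phi0 theta0 ratio N q phiq.
have [t1 [tau [Ht1 tau0 Hpoly]]] :=
  rotated_polynomial_bound a theta N q m r mu D tstar isT isT (ltW rpos) muE D0 HD thn th2.
exists t1, tau; split => //; first exact: le_lt_trans meta.
move=> t Ht z zr.
have B1' := ltW B1.
set x := 4^-1 + delta / 2.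
have Dx : D * Num.sqrt (q * m)%:R <= mu * (Num.sqrt (2 * c * m%:R) * B `^ (x + 2 * eps)).
  rewrite /D -mulrA ler_wpM2l ?(ltW mu0) //.
  apply: (sqrt_blocks_le _ _ _ s (1 + 2 * eps) _ _ _ N) => //; first exact: ltW.
  (* The inequality 1/2 + eps + (1 + 2 eps)(delta + eps) <= 2 (x + 2 eps) amounts to delta + eps <=
     1. *)
  by rewrite /s /x; clear -d0 d2 eps0 eps2; nra.
have ux := ln_sample_count_le B eps m q N B1' epsP isT N0 isT q2N NB; rewrite -/K1 in ux.
have u0 : 0 <= 2 + ln (4 * q * m * (8 * N ^ 2 + 1))%:R :> R.
  by rewrite addr_ge0 // ln_ge0 // ler1n !muln_gt0 /= addn1.
have uD : (2 + ln (4 * q * m * (8 * N ^ 2 + 1))%:R) * (D * Num.sqrt (q * m)%:R) <=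
   (K1 * Num.sqrt (2 * c * m%:R)) * (mu * B `^ (x + 3 * eps)).
  have DD0 : 0 <= D * Num.sqrt (q * m)%:R by rewrite mulr_ge0 ?sqrtr_ge0 // ltW.
  apply: (le_trans (ler_pM u0 DD0 ux Dx)).
  have -> : B `^ (x + 3 * eps) = B `^ eps * B `^ (x + 2 * eps).
    by rewrite -powRD ?(gt_eqF B0) ?implybT //; congr (_ `^ _); ring.
  by rewrite le_eqVlt; apply/orP; left; apply/eqP; ring.
have X0 : 0 <= 2 * ((m + 2)%:R * mu +
       2 * (2 + ln (4 * q * m * (8 * N ^ 2 + 1))%:R) * (D * Num.sqrt (q * m)%:R)).
  apply: mulr_ge0 => //; apply: addr_ge0; first by rewrite mulr_ge0 ?(ltW mu0).
  apply: mulr_ge0; first exact: mulr_ge0.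
  by rewrite mulr_ge0 ?sqrtr_ge0 ?(ltW D0).
have tl M : \sum_(n < M | (N <= n)%N) cmod (a n) * cmod z ^+ n <= 1.
  by rewrite zr; exact: Htail.
apply: (le_trans (power_sum_rotate_le theta t a z N _ X0 (Hpoly t Ht z zr) tl)).
apply: (@le_trans _ _ (K2 * mu * B `^ (x + 3 * eps))); last first.
  by apply: absorb => //; have := C2 (ltW d2); rewrite -/x; clear -epse; lra.
have Bx1 : 1 <= B `^ (x + 3 * eps).
  by rewrite -[leLHS](powRr0 B) ler_powR // /x; clear -d0 eps0; lra.
have muB : mu <= mu * B `^ (x + 3 * eps) by rewrite ler_peMr // ltW.
have h1 : (m + 2)%:R * mu <= (m + 2)%:R * (mu * B `^ (x + 3 * eps)).
  by rewrite ler_wpM2l.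
have h2 : 1 <= c * (mu * B `^ (x + 3 * eps)).
  by apply: (le_trans cmu); rewrite ler_wpM2l // ltW.
have collect (p M2 X u v k cc : R) : p <= M2 * X -> u * v <= k * X -> 1 <= cc * X ->
    2 * (p + 2 * u * v) + 1 <= (cc + 2 * M2 + 4 * k) * X by clear; lra.
by rewrite -[K2 * mu * _]mulrA; exact: collect.
Qed.

End DeltaBound.

(** * Residuality *)

Section Residual.
Context {R : realType}.

Lemma nonzero_coef (a : nat -> R[i]) (z : R[i]) :
  power_sum a z <> 0 -> exists n, a n != 0.
Proof.
move=> az; apply: contrapT => /forallNP a0; apply: az.
apply: ComplexField.Normc.eq0_normc; apply/eqP; rewrite eq_le cmod_ge0 andbT.
apply: (limn_le _ _ 0%N) => // M _; rewrite /partial_sums /series /= big1 ?cmod0 //.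
by move=> n _; have /negP := a0 n; rewrite negbK => /eqP ->; rewrite mul0r.
Qed.

(** Every left neighbourhood of 1 contains the point supplied by a large n, so its infimum is at
    most C + e for each e > 0. *)
Lemma limf_einf_at_left1_le (f : R -> R) (C : R) :
  (forall n : nat, exists r, 1 - n.+1%:R^-1 < r < 1 /\ f r <= C + n.+1%:R^-1) ->
  (limf_einf (fun r => (f r)%:E) 1^'- <= C%:E)%E.
Proof.
move=> H; rewrite limf_einfE; apply: ge_ereal_sup => _ [V HV <-].
move: HV => /nbhs_ballP[d /= d0 HV]; apply/lee_addgt0Pr => e e0.
pose n := Num.trunc (Num.max d^-1 e^-1).
have n1 : Num.max d^-1 e^-1 < n.+1%:R by exact: truncnS_gt.
move: n1; rewrite gt_max => /andP[nd ne].
have nd' : n.+1%:R^-1 < d by rewrite -[ltRHS]invrK ltf_pV2 ?posrE ?invr_gt0.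
have ne' : n.+1%:R^-1 < e by rewrite -[ltRHS]invrK ltf_pV2 ?posrE ?invr_gt0.
have [r [/andP[r1 r2] fr]] := H n.
apply: (@le_trans _ _ (f r)%:E).
  apply: ereal_inf_lbound; exists r => //; apply: HV => //=.
  rewrite /ball /= ger0_norm ?subr_ge0 ?(ltW r2) // (lt_trans _ nd') //.
  by move: r1; rewrite ltrBlDl ltrBlDr.
by rewrite -EFinD lee_fin (le_trans fr) // lerD2l ltW.
Qed.

(** The hypothesis on U says that its interior is dense. *)
Lemma nowhere_dense_avoiding (U A : set R) :
  (forall x eta, 0 < eta -> exists t1 tau,
    [/\ `|t1 - x| < eta, 0 < tau & forall t, `|t - t1| <= tau -> U t]) ->
  A `<=` ~` U -> nowhere_dense A.
Proof.
move=> HU AU; rewrite /nowhere_dense -subset0 => x /nbhs_ballP[eta /= eta0 Hx].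
have [t1 [tau [Ht1 tau0 Htau]]] := HU x eta eta0.
have : closure A t1 by apply: Hx; rewrite /ball /= distrC.
move=> /(_ _ (nbhsx_ballx t1 tau tau0))[t [At]].
rewrite /ball /= distrC => /ltW /Htau; exact: AU At.
Qed.

End Residual.

Theorem theorem4p3 (R : realType) (delta : R) (theta : nat -> nat)
  (delta_ge0 : 0 <= delta)
  (theta_gt0 : forall n, (0 < theta n)%N)
  (theta_growth : exists phi : R -> R,
     [/\ class_L phi,
         (gamma phi <= delta%:E)%E,
         (forall n : nat, 0 < phi n%:R)
       & forall n : nat,
           (theta n.+1)%:R / (theta n)%:R >= 1 + 1 / phi n%:R])
  (a : nat -> R[i])
  (a_analytic : analytic_in_disc a)
  (a_neq0 : exists z : R[i], cmod z < 1 /\ power_sum a z <> 0) :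
  residual (F3h delta theta a).
Proof.
have [phi [phiL gphi phi0 ratio]] := theta_growth.
have [z [_ /nonzero_coef an0]] := a_neq0.
pose C : R := (1 + 3 * delta) / (4 + 2 * delta).
(* A point t that lies in every [U n] belongs to [F3h], by [limf_einf_at_left1_le]. *)
pose U (n : nat) : set R := [set t | exists r, 1 - n.+1%:R^-1 < r < 1 /\
  Delta h_disc (rotate theta t a) r <= C + n.+1%:R^-1].
(* Intersecting with the complement of [F3h] makes the union equal to it, as [first_category]
   demands. *)
exists (fun n => (~` U n `&` ~` F3h delta theta a)); split.
  move=> n; apply: (nowhere_dense_avoiding (U n)); last by move=> t [].
  move=> x eta eta0; have n0 : 0 < n.+1%:R^-1 :> R by rewrite invr_gt0.
  have rn : 1 - n.+1%:R^-1 < 1 :> R by rewrite gtrBl.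
  have [r [t1 [tau [rr Ht1 tau0 H]]]] := rotations_Delta_le delta theta phi a
    _ _ x eta delta_ge0 theta_gt0 phiL gphi phi0 ratio a_analytic an0 rn n0 eta0.
  exists t1, tau; split => // t Ht; exists r; split; [exact: rr|exact: H].
apply/seteqP; split => [t Ft|t [n _ []] //].
apply: contrapT => Hno; apply: (Ft); apply: limf_einf_at_left1_le => n.
by apply: contrapT => HU; apply: Hno; exists n => //; split.
Qed.
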